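(* Let $f\in\mathbb{R}^q$ and let $B$ be a maximal lattice-free convex set in $\mathbb{R}^q$ with $f$ in its interior. Let $L=\mathrm{lin}(B)$ be the lineality space of $B$ and let $P=B\cap(f+L^\perp)$. Then $B=P+L$, $L$ is a rational space, and $P$ is a polytope. Let $v^1,\dots,v^k$ be the vertices of $P$, let $r^{k+1},\dots,r^{k+h}$ be a rational basis of $L$ (a basis consisting of rational vectors), and define $r^j=v^j-f$ for $j=1,\dots,k$. Then the inequality $\sum_{r\in\mathbb{R}^q}\psi_B(r)s_r\ge 1$ is extreme for $R_f(\mathbb{R}^q)$ if and only if the inequality $\sum_{j=1}^k s_j\ge 1$ is extreme for $\mathrm{conv}(R_f(r^1,\dots,r^{k+h}))$.
   Context: A set $B\subseteq\mathbb{R}^q$ is a maximal lattice-free convex set in $\mathbb{R}^q$ if it is convex, has no point of $\mathbb{Z}^q$ in its interior, and is inclusionwise maximal with these properties. Such a $B$ with $f$ in its interior is known to be a polyhedron, so it can be written irredundantly (one inequality per facet) as $B=\{x\in\mathbb{R}^q : a_i(x-f)\le 1,\ i=1,\dots,t\}$; then $\psi_B(r)=\max_{i=1,\dots,t}a_ir$ for $r\in\mathbb{R}^q$. A linear subspace is rational if it is spanned by its integral vectors. $L^\perp$ is the orthogonal complement of $L$. $R_f(\mathbb{R}^q)$ is the set of all finitely supported $s=(s_r)_{r\in\mathbb{R}^q}$ with $s_r\ge0$ for all $r$ and $f+\sum_{r\in\mathbb{R}^q}rs_r\in\mathbb{Z}^q$. For vectors $r^1,\dots,r^m\in\mathbb{R}^q$,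 $R_f(r^1,\dots,r^m)$ is the set of $s\in\mathbb{R}^m$ with $s\ge0$ and $f+\sum_{j=1}^m r^js_j\in\mathbb{Z}^q$. An inequality is valid for a set if all points of the set satisfy it. A valid inequality $\sum_{r\in\mathbb{R}^q}\psi(r)s_r\ge1$ for $R_f(\mathbb{R}^q)$ is extreme if there do not exist distinct functions $\psi_1,\psi_2:\mathbb{R}^q\to\mathbb{R}$ with $\psi\ge\frac12(\psi_1+\psi_2)$ pointwise such that $\sum_{r}\psi_i(r)s_r\ge1$, $i=1,2$, are both valid for $R_f(\mathbb{R}^q)$. Analogously, a valid inequality $\sum_{j=1}^{m}\gamma_js_j\ge1$ for $R_f(r^1,\dots,r^m)$ (equivalently, for its convex hull) is extreme if there do not exist distinct vectors $\alpha,\beta\in\mathbb{R}^m$ with $\gamma_j\ge\frac12(\alpha_j+\beta_j)$ for all $j$ such that $\alpha s\ge1$ and $\beta s\ge1$ are both valid for $R_f(r^1,\dots,r^m)$. *)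

(* Defs.v *)
From mathcomp Require Import all_boot all_order all_algebra.
From mathcomp Require Import boolp classical_sets functions cardinality fsbigop.
From mathcomp Require Import reals topology normedtype convex.

Set Implicit Arguments.
Unset Strict Implicit.
Unset Printing Implicit Defensive.

Import Order.TTheory GRing.Theory Num.Theory.
Import numFieldNormedType.Exports.
Local Open Scope classical_set_scope.
Local Open Scope ring_scope.

Section EuclideanSpace.
Variables (R : realType) (q : nat).
Implicit Types (x y u v f : 'rV[R]_q) (A B L P : set 'rV[R]_q).

Definition dot u v : R := \sum_(i < q) u 0 i * v 0 i.

Definition lattice : set 'rV[R]_q := [set z | z \is a mxOver Num.int].

Definition rational_vector u : Prop :=
  exists w : 'rV[rat]_q, u = map_mx ratr w.

Definition lattice_free B : Prop := B° `&` lattice = set0.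

Definition maximal_lattice_free_convex B : Prop :=
  [/\ @convex_set R 'rV[R]_q B, lattice_free B &
      forall C, @convex_set R 'rV[R]_q C -> lattice_free C ->
        B `<=` C -> C = B].

Definition lineality_space B : set 'rV[R]_q :=
  [set u | forall x (l : R), B x -> B (x + l *: u)].

Definition orthogonal_complement L : set 'rV[R]_q :=
  [set y | forall u, L u -> dot u y = 0].

Definition linear_span A : set 'rV[R]_q :=
  [set x | exists2 X : seq 'rV[R]_q,
             (forall u, u \in X -> A u) & x \in <<X>>%VS].

(* The equation also forces L to be a linear subspace. *)
Definition rational_space L : Prop := L = linear_span (L `&` lattice).

Definition rational_basis L h (b : 'I_h -> 'rV[R]_q) : Prop :=
  [/\ free [seq b j | j <- enum 'I_h],
      L = [set x | x \in <<[seq b j | j <- enum 'I_h]>>%VS] &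
      forall j, rational_vector (b j)].

Definition convex_hull A : set 'rV[R]_q :=
  [set y | exists n (x : 'I_n -> 'rV[R]_q) (w : 'I_n -> R),
     [/\ forall i, A (x i), forall i, 0 <= w i, \sum_i w i = 1 &
         y = \sum_i w i *: x i]].

Definition polytope P : Prop :=
  exists2 A, finite_set A & P = convex_hull A.

(* The 0-dimensional faces of P. *)
Definition vertices P : set 'rV[R]_q :=
  [set v | exists (c : 'rV[R]_q) (d : R),
     (forall x, P x -> dot c x <= d) /\
     P `&` [set x | dot c x = d] = [set v]].

(* The number of inequalities is written t.+1 because a lattice-free set is
   never the whole space. *)
Definition irredundant_description f B t (a : 'I_t.+1 -> 'rV[R]_q) : Prop :=
  B = [set x | forall i, dot (a i) (x - f) <= 1] /\
  forall i, [set x | forall j, j != i -> dot (a j) (x - f) <= 1] <> B.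

(* The maximum over i of dot (a i) r; starting from the value at ord0, rather
   than from 0, lets it be negative. *)
Definition psi_of t (a : 'I_t.+1 -> 'rV[R]_q) (r : 'rV[R]_q) : R :=
  \big[Num.max/dot (a ord0) r]_(i < t.+1) dot (a i) r.

Definition Rf_infinite f : set ('rV[R]_q -> R) :=
  [set s | [/\ finite_set [set r | s r != 0], forall r, 0 <= s r &
               lattice (f + \sum_(r \in [set: 'rV[R]_q]) s r *: r)]].

Definition valid_infinite f (psi : 'rV[R]_q -> R) : Prop :=
  forall s, Rf_infinite f s ->
    1 <= \sum_(r \in [set: 'rV[R]_q]) psi r * s r.

Definition extreme_infinite f (psi : 'rV[R]_q -> R) : Prop :=
  valid_infinite f psi /\
  ~ exists psi1 psi2 : 'rV[R]_q -> R,
      [/\ psi1 <> psi2, forall r, psi r >= (psi1 r + psi2 r) / 2,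
          valid_infinite f psi1 & valid_infinite f psi2].

Definition Rf_finite f m (r : 'I_m -> 'rV[R]_q) : set 'rV[R]_m :=
  [set s | (forall j, 0 <= s 0 j) /\ lattice (f + \sum_j s 0 j *: r j)].

(* r^1, ..., r^k, r^{k+1}, ..., r^{k+h} with r^j = v^j - f for j <= k. *)
Definition rays f k h (v : 'I_k -> 'rV[R]_q) (b : 'I_h -> 'rV[R]_q)
    (j : 'I_(k + h)) : 'rV[R]_q :=
  match fintype.split j with inl i => v i - f | inr i => b i end.

End EuclideanSpace.

Definition valid_inequality (R : realType) m (S : set 'rV[R]_m)
    (gamma : 'rV[R]_m) : Prop :=
  forall s, S s -> 1 <= dot gamma s.

Definition extreme_inequality (R : realType) m (S : set 'rV[R]_m)
    (gamma : 'rV[R]_m) : Prop :=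
  valid_inequality S gamma /\
  ~ exists alpha beta : 'rV[R]_m,
      [/\ alpha <> beta,
          forall j, gamma 0 j >= (alpha 0 j + beta 0 j) / 2,
          valid_inequality S alpha & valid_inequality S beta].

(* Coefficient vector of s_1 + ... + s_k >= 1 in the variables
   s_1, ..., s_{k+h}. *)
Definition first_ones (R : realType) k h : 'rV[R]_(k + h) :=
  row_mx (const_mx 1) 0.

(* Main.v *)
(* Adding to B a line whose multiples come arbitrarily close, modulo the lattice,
   to its recession cone keeps B lattice-free, so by maximality such a line lies
   in L. By Dirichlet approximation every recession direction of B is therefore
   in L, hence P is bounded; and the projection of the lattice to the orthogonal
   complement of L is discrete, hence L is rational. Only finitely many
   projected lattice points are near P, and by maximality the halfspaces
   supporting B at these cut out B together with a box.

   For the equivalence, every r is a nonnegative combination of the r^j, j <= k,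
   with total weight psi_B(r), plus a vector of L. A splitting of the finite
   inequality vanishes on the basis of L and extends along these combinations.
   Conversely, a splitting of psi_B restricts to the r^j. If the two restrictions
   coincide, both functions are at most psi_B on the r^j, and maximality of B
   forces them to be at least psi_B everywhere, so they are both equal to it. *)

Require Import Defs.
From mathcomp Require Import all_boot all_order all_algebra.
From mathcomp Require Import boolp classical_sets functions cardinality fsbigop.
From mathcomp Require Import interval_inference.
From mathcomp Require Import reals topology normedtype convex derive.
From mathcomp Require Import ring lra.

Set Implicit Arguments.
Unset Strict Implicit.
Unset Printing Implicit Defensive.

Import Order.TTheory GRing.Theory Num.Theory.
Import numFieldNormedType.Exports.
Local Open Scope classical_set_scope.
Local Open Scope ring_scope.

(** * Euclidean space *)

Section Dot.
Variables (R : realType) (q : nat).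
Implicit Types (x y u v : 'rV[R]_q) (c : R).

Lemma dotC u v : dot u v = dot v u.
Proof. by apply: eq_bigr => i _; rewrite mulrC. Qed.

Lemma dotDr u x y : dot u (x + y) = dot u x + dot u y.
Proof. by rewrite -big_split /=; apply: eq_bigr => i _; rewrite mxE mulrDr. Qed.

Lemma dotZr u c x : dot u (c *: x) = c * dot u x.
Proof. by rewrite mulr_sumr; apply: eq_bigr => i _; rewrite mxE mulrCA. Qed.

Lemma dotNr u x : dot u (- x) = - dot u x.
Proof. by rewrite -scaleN1r dotZr mulN1r. Qed.

Lemma dotBr u x y : dot u (x - y) = dot u x - dot u y.
Proof. by rewrite dotDr dotNr. Qed.

Lemma dot0r u : dot u 0 = 0.
Proof. by rewrite -(scale0r 0) dotZr mul0r. Qed.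

Lemma dotDl u x y : dot (x + y) u = dot x u + dot y u.
Proof. by rewrite dotC dotDr !(dotC u). Qed.

Lemma dotZl u c x : dot (c *: x) u = c * dot x u.
Proof. by rewrite dotC dotZr (dotC u). Qed.

Lemma dotNl u x : dot (- x) u = - dot x u.
Proof. by rewrite dotC dotNr (dotC u). Qed.

Lemma dotBl u x y : dot (x - y) u = dot x u - dot y u.
Proof. by rewrite dotDl dotNl. Qed.

Lemma dot0l u : dot 0 u = 0.
Proof. by rewrite dotC dot0r. Qed.

Lemma dot_sumr (I : Type) (s : seq I) (Q : pred I) u (F : I -> 'rV[R]_q) :
  dot u (\sum_(i <- s | Q i) F i) = \sum_(i <- s | Q i) dot u (F i).
Proof.
by elim/big_rec2: _ => [|i c v _ <-]; rewrite ?dot0r ?dotDr.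
Qed.

Lemma dot_suml (I : Type) (s : seq I) (Q : pred I) u (F : I -> 'rV[R]_q) :
  dot (\sum_(i <- s | Q i) F i) u = \sum_(i <- s | Q i) dot (F i) u.
Proof. by rewrite dotC dot_sumr; apply: eq_bigr => i _; rewrite dotC. Qed.

Lemma dot_ge0 u : 0 <= dot u u.
Proof. by apply: sumr_ge0 => i _; rewrite -expr2 sqr_ge0. Qed.

Lemma dot_eq0 u : (dot u u == 0) = (u == 0).
Proof.
apply/eqP/eqP => [/eqP|->]; last by rewrite dot0r.
rewrite psumr_eq0 => [/allP uu0|i _]; last by rewrite -expr2 sqr_ge0.
apply/rowP => i; rewrite mxE; apply/eqP.
by have := uu0 i (mem_index_enum _); rewrite mulf_eq0 orbb.
Qed.

Lemma dot_gt0 u : (0 < dot u u) = (u != 0).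
Proof. by rewrite lt_def dot_ge0 andbT dot_eq0. Qed.

Lemma normr_coord_le x i : `|x 0 i| <= `|x|.
Proof.
rewrite [leRHS]/Num.norm /= mx_normrE.
by apply: (le_bigmax _ (fun j : 'I_1 * 'I_q => `|x j.1 j.2|) (0, i)).
Qed.

Lemma normr_row_le x c : 0 <= c -> (forall i, `|x 0 i| <= c) -> `|x| <= c.
Proof.
move=> c0 xc; rewrite [leLHS]/Num.norm /= mx_normrE.
by apply/bigmax_leP; split=> // -[i j] _ /=; rewrite ord1.
Qed.

Lemma dot_delta i x : dot (delta_mx 0 i) x = x 0 i.
Proof.
rewrite /dot (bigD1 i) //= big1 => [|j ji]; rewrite mxE ?eqxx ?mul1r ?addr0//.
by rewrite (negbTE ji) mul0r.
Qed.

Lemma normr_dot_le u v : `|dot u v| <= q%:R * `|u| * `|v|.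
Proof.
apply: le_trans (ler_norm_sum _ _ _) _.
apply: (@le_trans _ _ (\sum_(i < q) `|u| * `|v|)).
  by apply: ler_sum => i _; rewrite normrM ler_pM// normr_coord_le.
by rewrite sumr_const card_ord -[leLHS]mulr_natl mulrA.
Qed.

End Dot.

(** * Metric forms of topological notions on row vectors *)

Section Topology.
Variables (R : realType) (q : nat).
Implicit Types (x y u v : 'rV[R]_q) (A B : set 'rV[R]_q).

Lemma interior_ballP A x :
  A° x <-> exists2 e : R, 0 < e & forall y, `|y - x| < e -> A y.
Proof.
split=> [/nbhs_ballP[e e0 xA]|[e e0 xA]].
  by exists e => // y yx; apply: xA; rewrite -ball_normE /ball_/= distrC.
by apply/nbhs_ballP; exists e => // y; rewrite -ball_normE /ball_/= distrC => /xA.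
Qed.

Lemma closure_ballP A x :
  closure A x <-> forall e : R, 0 < e -> exists2 y, A y & `|y - x| < e.
Proof.
split=> [xA e e0|xA C /nbhs_ballP[e e0 xC]].
  have [y [Ay]] := xA _ (nbhsx_ballx x e e0).
  by rewrite -ball_normE /ball_/= distrC; exists y.
have [y Ay yx] := xA e e0; exists y; split=> //.
by apply: xC; rewrite -ball_normE /ball_/= distrC.
Qed.

Lemma convexP A : @convex_set R 'rV[R]_q A <->
  forall x y (t : R), 0 <= t -> t <= 1 -> A x -> A y ->
    A (t *: x + (1 - t) *: y).
Proof.
split=> [cA x y t t0 t1 Ax Ay|cA x y t /set_mem Ax /set_mem Ay].
  have t01 : (0 <= t <= 1)%R by rewrite t0.
  have := cA x y (@Itv01 R t t0 t1) (mem_set Ax) (mem_set Ay).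
  by move=> /set_mem.
apply/mem_set; apply: cA => //.
Qed.

(** Closed balls are compact. A cluster point, with arbitrarily late terms near it, takes the place
    of a convergent subsequence. *)
Lemma bolzano_weierstrass (X : nat -> 'rV[R]_q) (M : R) :
  (forall n, `|X n| <= M) ->
  exists l, forall (e : R) N, 0 < e -> exists2 n, (N <= n)%N & `|X n - l| < e.
Proof.
move=> XM; set A := [set x : 'rV[R]_q | `|x| <= M].
have cA : compact A.
  apply: bounded_closed_compact.
    by exists M; split=> [|m Mm x /le_trans]; [exact: num_real|apply; exact: ltW].
  move=> x /closure_ballP xA; apply/ler_addgt0Pr => e e0.
  have [y yM yx] := xA e e0.
  rewrite -(subrK y x) addrC (le_trans (ler_normD _ _))// lerD//.
  by rewrite distrC ltW.
have [|l [_ clu]] := cA (X @ \oo) _.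
  by exists 0%N => // n _; exact: XM.
exists l => e N e0.
have := clu (X @` [set n | (N <= n)%N]) (ball l e) _ (nbhsx_ballx l e e0).
case.
  by exists N => // n /= Nn; exists n.
move=> _ [[n Nn <-]]; rewrite -ball_normE /ball_/= distrC.
by exists n.
Qed.

Lemma normr_mulmx_le (M : 'M[R]_q) :
  exists2 c : R, 0 < c & forall x, `|x *m M| <= c * `|x|.
Proof.
(* The summand [1] keeps the constant positive even for [M = 0], so that it can be divided by. *)
exists (q%:R * \sum_i \sum_j `|M i j| + 1) => [|x].
  by rewrite ltr_wpDl// mulr_ge0// sumr_ge0// => i _; rewrite sumr_ge0.
apply: normr_row_le => [|j].
  rewrite mulr_ge0// addr_ge0// mulr_ge0// sumr_ge0// => i _.
  by rewrite sumr_ge0.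
rewrite mxE (le_trans (ler_norm_sum _ _ _))//.
apply: (@le_trans _ _ (\sum_(i < q) (\sum_i \sum_j `|M i j|) * `|x|)).
  apply: ler_sum => i _; rewrite normrM mulrC ler_pM ?normr_coord_le//.
  rewrite (bigD1 i)//= (bigD1 j)//= -addrA lerDl addr_ge0//.
    by rewrite sumr_ge0.
  by rewrite sumr_ge0// => k _; rewrite sumr_ge0.
by rewrite sumr_const card_ord -[leLHS]mulr_natl mulrA ler_wpM2r// lerDl.
Qed.

End Topology.

(** * Linear subspaces and orthogonal projection *)

Section Subspaces.
Variables (R : realType) (q : nat).
Implicit Types (x y u v w : 'rV[R]_q) (L : set 'rV[R]_q) (W : {vspace 'rV[R]_q}).

(** Among the vector spaces inside [L] one has maximal dimension; a vector [x] of [L] outside it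
    would give the larger [W + <[x]>]. *)
Lemma subspace_vspace L : L 0 -> (forall x y, L x -> L y -> L (x + y)) ->
    (forall c x, L x -> L (c *: x)) ->
  exists W, L = [set x | x \in W].
Proof.
move=> L0 LD LZ.
pose good n := `[< exists2 W : {vspace 'rV[R]_q},
    (forall x, x \in W -> L x) & \dim W = n >].
have good0 : exists n, good n.
  exists 0%N; apply/asboolP; exists 0%VS => [x|]; last exact: dimv0.
  by rewrite memv0 => /eqP ->.
have goodM n : good n -> (n <= \dim {:'rV[R]_q})%N.
  by move=> /asboolP[W _ <-]; rewrite dimvS// subvf.
case: (ex_maxnP good0 goodM) => m /asboolP[W WL Wm] maxm.
exists W; apply/seteqP; split=> [x Lx /=|x /WL//].
apply: contrapT => /negP xW.
have : good (\dim (W + <[x]>)%VS).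
  apply/asboolP; exists (W + <[x]>)%VS => // y /memv_addP[w /WL Lw [z]].
  by move=> /vlineP[c ->] ->; apply: LD => //; exact: LZ.
move=> /maxm; rewrite -Wm => dimW.
have /eqP WE : W == (W + <[x]>)%VS by rewrite eqEdim addvSl.
by move: xW; rewrite WE memvE addvSr.
Qed.

(** Gram-Schmidt in matrix form, by induction on a list spanning [W]: each new vector [x]
    contributes its component [w] orthogonal to the others. *)
Lemma orthogonal_projection W : exists M : 'M[R]_q,
  [/\ forall x u, u \in W -> dot u (x *m M) = 0,
      forall x, x - x *m M \in W,
      forall x, x \in W -> x *m M = 0 &
      forall y, (forall u, u \in W -> dot u y = 0) -> y *m M = y].
Proof.
(* The other two properties follow: for [x] in [W], [x *m M] lies in [W] and is orthogonal to [W];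
   for [y] orthogonal to [W], so is [y - y *m M], which lies in [W]. *)
suff [M [M1 M2]] : exists M : 'M[R]_q,
    (forall x u, u \in W -> dot u (x *m M) = 0) /\ (forall x, x - x *m M \in W).
  exists M; split=> // [x xW|y yW].
    have xMW : x *m M \in W.
      by rewrite -[x *m M](subKr x) rpredB.
    by apply/eqP; rewrite -dot_eq0 M1.
  apply/esym/eqP; rewrite -subr_eq0 -dot_eq0 dotBr yW ?M2//.
  by rewrite M1 ?M2// subr0.
rewrite -(span_basis (vbasisP W)); elim: (vbasis W : seq _) => [|x X [M [M1 M2]]].
  exists 1%:M; split=> [x u|x].
    by rewrite span_nil memv0 => /eqP ->; rewrite dot0l.
  by rewrite mulmx1 subrr mem0v.
set w := x *m M; have [w0|w0] := eqVneq w 0.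
  exists M; have -> : <<x :: X>>%VS = <<X>>%VS.
    by rewrite span_cons; apply/addv_idPr; rewrite -memvE -[x]subr0 -w0 M2.
  by split.
(* This is [M] followed by the projection orthogonal to [w]. *)
exists (M - (dot w w)^-1 *: (M *m w^T *m w)).
have ME y : y *m (M - (dot w w)^-1 *: (M *m w^T *m w)) =
    y *m M - (dot w (y *m M) / dot w w) *: w.
  rewrite mulmxBr -scalemxAr (mulmxA y) (mulmxA y).
  rewrite [_ / _]mulrC -scalerA [y *m M *m w^T]mx11_scalar mul_scalar_mx.
  suff -> : (y *m M *m w^T) 0 0 = dot w (y *m M) by [].
  by rewrite mxE /dot; apply: eq_bigr => i _; rewrite [w^T _ _]mxE mulrC.
have wx : x - w \in <<X>>%VS by exact: M2.
split=> [y u|y]; last first.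
  have XS : (<<X>> <= <<x :: X>>)%VS by rewrite span_cons addvSr.
  rewrite ME opprB addrCA; apply: rpredD; last exact/(subvP XS)/M2.
  apply: memvZ; rewrite -[w](subKr x); apply: rpredB; last exact/(subvP XS).
  by rewrite memv_span ?mem_head.
rewrite span_cons => /memv_addP[_ /vlineP[c ->] [v vX ->]].
have Xw z : z \in <<X>>%VS -> dot z w = 0 by exact: M1.
have Xy z : z \in <<X>>%VS -> dot z (y *m M) = 0 by exact: M1.
rewrite ME dotDl dotZl [dot v _]dotBr dotZr (Xw v)// (Xy v)// mulr0 subr0 addr0.
rewrite -[x in dot x _](subrK w) dotDl [dot (x - w) _]dotBr dotZr.
rewrite (Xw _ wx) (Xy _ wx) mulr0 subr0 add0r.
by rewrite dotBr dotZr divfK ?dot_eq0// subrr mulr0.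
Qed.

End Subspaces.

(** * The integer lattice and Dirichlet approximation *)

Section Lattice.
Variables (R : realType) (q : nat).
Implicit Types (x y u v w z : 'rV[R]_q) (A B : set 'rV[R]_q).

Lemma latticeP z : lattice z <-> forall i, z 0 i \is a Num.int.
Proof.
split=> [/mxOverP zi i|zi]; first exact: zi.
by apply/mxOverP => i j; rewrite ord1.
Qed.

Lemma lattice0 : lattice (0 : 'rV[R]_q).
Proof. by apply/latticeP => i; rewrite mxE rpred0. Qed.

Lemma latticeD x y : lattice x -> lattice y -> lattice (x + y).
Proof.
by move=> /latticeP xi /latticeP yi; apply/latticeP => i; rewrite mxE rpredD.
Qed.

Lemma latticeZ (c : R) x : c \is a Num.int -> lattice x -> lattice (c *: x).
Proof.
by move=> ci /latticeP xi; apply/latticeP => i; rewrite mxE rpredM.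
Qed.

Lemma latticeN x : lattice x -> lattice (- x).
Proof. by move=> xl; rewrite -scaleN1r; apply: latticeZ; rewrite ?rpredN1. Qed.

Lemma latticeB x y : lattice x -> lattice y -> lattice (x - y).
Proof. by move=> xl yl; apply/latticeD/latticeN. Qed.

Lemma lattice_sum (I : Type) (s : seq I) (Q : pred I) (F : I -> 'rV[R]_q) :
  (forall i, Q i -> lattice (F i)) -> lattice (\sum_(i <- s | Q i) F i).
Proof.
move=> Fl; elim/big_rec: _ => [|i x Qi xl]; first exact: lattice0.
by apply: latticeD => //; exact: Fl.
Qed.

(** The differences between [n x] and its coordinatewise floor are bounded, so two of them with
    indices at least [N] apart lie near a common cluster point; [k] is the difference of these
    indices. *)
Lemma dirichlet x (e : R) N : 0 < e ->
  exists2 k : nat, (N <= k)%N & exists2 w, lattice w & `|k%:R *: x - w| < e.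
Proof.
move=> e0.
pose W (n : nat) : 'rV[R]_q := \row_i (Num.floor (n%:R * x 0 i))%:~R.
have Wl n : lattice (W n).
  apply/latticeP => i; rewrite mxE. exact: intr_int.
have WM n : `|n%:R *: x - W n| <= 1.
  apply: normr_row_le => // i; rewrite !mxE.
  have := real_floor_itv (num_real (n%:R * x 0 i)).
  rewrite intrD => /andP[h1 h2]; rewrite ger0_norm; lra.
have [l lP] := bolzano_weierstrass WM.
have [n _ nl] := lP (e / 2) 0%N (divr_gt0 e0 (ltr0Sn _ _)).
have [m nm ml] := lP (e / 2) (n + N)%N (divr_gt0 e0 (ltr0Sn _ _)).
have nm' := leq_trans (leq_addr _ _) nm.
exists (m - n)%N; first by rewrite -(leq_add2l n) subnKC.
exists (W m - W n); first exact: latticeB.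
have -> : (m - n)%:R *: x - (W m - W n) =
    (m%:R *: x - W m - l) - (n%:R *: x - W n - l).
  by rewrite natrB// scalerBl; apply/rowP => i; rewrite !mxE; ring.
rewrite (le_lt_trans (ler_normB _ _))//; lra.
Qed.

End Lattice.

(** * Interior and closure of convex sets *)

Section Convex.
Variables (R : realType) (q : nat).
Implicit Types (x y u v w z f : 'rV[R]_q) (A B : set 'rV[R]_q).

Lemma interior_extend A f x : A° x ->
  exists2 e : R, 0 < e & A (f + (1 + e) *: (x - f)).
Proof.
move=> /interior_ballP[e e0 xA].
have d0 : 0 < 1 + `|x - f| by rewrite ltr_pwDl.
exists (e / (1 + `|x - f|)); first exact: divr_gt0.
apply: xA; rewrite scalerDl scale1r addrA (addrC f) subrK addrAC subrr add0r.
rewrite normrZ gtr0_norm ?divr_gt0// mulrAC ltr_pdivrMr// ltr_pM2l//.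
by rewrite ltrDr.
Qed.

(** A point near [f + t (x - f)] is a combination of a point of [A] near [x], with weight [t], and a
    point so near to [f] that it lies in [A]. *)
Lemma convex_interior_line A f x (t : R) : @convex_set R 'rV[R]_q A ->
  A° f -> closure A x -> 0 <= t -> t < 1 -> A° (f + t *: (x - f)).
Proof.
move=> /convexP cA /interior_ballP[e e0 fA] /closure_ballP xA t0 t1.
have t1' : 0 < 1 - t by rewrite subr_gt0.
have d0 : 0 < e * (1 - t) / 2 by rewrite divr_gt0 ?mulr_gt0.
apply/interior_ballP; exists (e * (1 - t) / 2) => // y yx.
have [x' Ax' xx'] := xA _ d0.
have -> : y = t *: x' + (1 - t) *: ((1 - t)^-1 *: (y - t *: x')).
  by rewrite scalerA divff ?gt_eqF// scale1r addrC subrK.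
apply: cA => //; first exact: ltW.
apply: fA.
have -> : (1 - t)^-1 *: (y - t *: x') - f =
    (1 - t)^-1 *: (y - (f + t *: (x - f)) - t *: (x' - x)).
  by apply/rowP => i; rewrite !mxE; field; rewrite gt_eqF.
rewrite normrZ gtr0_norm ?invr_gt0// mulrC ltr_pdivrMr//.
rewrite (le_lt_trans (ler_normB _ _))// normrZ ger0_norm//.
have : t * `|x' - x| <= 1 * `|x' - x| by rewrite ler_wpM2r// ltW.
lra.
Qed.

Lemma convex_closure A : @convex_set R 'rV[R]_q A ->
  @convex_set R 'rV[R]_q (closure A).
Proof.
move=> /convexP cA; apply/convexP => x y t t0 t1.
move=> /closure_ballP xA /closure_ballP yA.
apply/closure_ballP => e e0.
have [x' Ax' xx'] := xA _ e0; have [y' Ay' yy'] := yA _ e0.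
exists (t *: x' + (1 - t) *: y'); first exact: cA.
have -> : t *: x' + (1 - t) *: y' - (t *: x + (1 - t) *: y) =
    t *: (x' - x) + (1 - t) *: (y' - y).
  by apply/rowP => i; rewrite !mxE; ring.
rewrite (le_lt_trans (ler_normD _ _))// !normrZ !ger0_norm ?subr_ge0//.
have [->|t0'] := eqVneq t 0; first lra.
have t0'' : 0 < t by rewrite lt_def t0'.
have : t * `|x' - x| < t * e by rewrite ltr_pM2l.
have : (1 - t) * `|y' - y| <= (1 - t) * e.
  by rewrite ler_wpM2l ?subr_ge0// ltW.
lra.
Qed.

End Convex.

(** * Limits of directions *)

Section Cluster.
Variables (R : realType) (q : nat).

Lemma unit_cluster (y : nat -> 'rV[R]_q) : (forall n, y n != 0) ->
  exists2 l, `|l| = 1 & forall (e : R) N, 0 < e ->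
    exists2 n, (N <= n)%N & `| `|y n|^-1 *: y n - l| < e.
Proof.
move=> y0; pose u n := `|y n|^-1 *: y n.
have u1 n : `|u n| = 1.
  by rewrite normrZ gtr0_norm ?invr_gt0 ?normr_gt0// mulVf// normr_eq0.
have u1' n : `|u n| <= 1 by rewrite u1.
have [l lP] := bolzano_weierstrass u1'.
exists l => //; apply/eqP; rewrite -subr_eq0 -normr_eq0 eq_le normr_ge0 andbT.
apply/ler_addgt0Pl => e e0; rewrite addr0; have [n _ ne] := lP e 0%N e0.
by rewrite -(u1 n) (le_trans _ (ltW ne))// distrC; exact: ler_dist_dist.
Qed.

Lemma mulmx_fixed_closed (M : 'M[R]_q) (l : 'rV[R]_q) :
  (forall e : R, 0 < e -> exists2 x : 'rV[R]_q, x *m M = x & `|x - l| < e) ->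
  l *m M = l.
Proof.
move=> hl; apply/eqP; rewrite -subr_eq0 -normr_eq0 eq_le normr_ge0 andbT.
have [c c0 cM] := normr_mulmx_le M.
apply/ler_addgt0Pl => e e0; rewrite addr0.
have c1 : 0 < c + 1 by rewrite ltr_wpDl// ltW.
(* The factor [c + 1] bounds both terms of [(l - x) *m M + (x - l)]. *)
have [x xM xl] := hl (e / (c + 1)) (divr_gt0 e0 c1).
have -> : l *m M - l = (l - x) *m M + (x - l).
  by rewrite mulmxBl xM addrA subrK.
rewrite (le_trans (ler_normD _ _))// (le_trans (lerD (cM _) (lexx _)))//.
rewrite distrC -{2}[`|_|]mul1r -mulrDl -ler_pdivlMl// mulrC.
exact: ltW.
Qed.

End Cluster.

(** * Polyhedra *)

Section Polyhedra.
Variables (R : realType) (q : nat).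
Implicit Types (x y u v : 'rV[R]_q) (s : seq ('rV[R]_q * R)) (A P : set 'rV[R]_q).

Definition polyhedron s : set 'rV[R]_q :=
  [set x | forall c, c \in s -> dot c.1 x <= c.2].

(** The algebraic form of a vertex: the tight constraints determine the point. Finiteness and the
    hull theorem are proved in this form. *)
Definition basic_point s x := polyhedron s x /\
  forall u, (forall c, c \in s -> dot c.1 x = c.2 -> dot c.1 u = 0) -> u = 0.

Lemma polyhedron_convex s : @convex_set R 'rV[R]_q (polyhedron s).
Proof.
apply/convexP => x y t t0 t1 xs ys c cs; rewrite dotDr !dotZr.
have : t * dot c.1 x <= t * c.2 by rewrite ler_wpM2l ?xs.
have : (1 - t) * dot c.1 y <= (1 - t) * c.2 by rewrite ler_wpM2l ?ys ?subr_ge0.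
lra.
Qed.

Lemma convex_hull_sub A x : A x -> convex_hull A x.
Proof.
move=> Ax; exists 1%N, (fun=> x), (fun=> 1); split=> //.
  by rewrite big_ord1.
by rewrite big_ord1 scale1r.
Qed.

Lemma convex_hull_convex A x y (t : R) : 0 <= t -> t <= 1 ->
  convex_hull A x -> convex_hull A y -> convex_hull A (t *: x + (1 - t) *: y).
Proof.
move=> t0 t1 [n [a [w [Aa w0 w1 ->]]]] [m [b [z [Ab z0 z1 ->]]]].
exists (n + m)%N,
  (fun i => match fintype.split i with inl j => a j | inr j => b j end),
  (fun i => match fintype.split i with
            | inl j => t * w j | inr j => (1 - t) * z j end); split.
- by move=> i; case: fintype.split.
- by move=> i; case: fintype.split => j; rewrite mulr_ge0// subr_ge0.
- rewrite big_split_ord/=.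
  under eq_bigr do rewrite (unsplitK (inl _)).
  under [X in _ + X]eq_bigr do rewrite (unsplitK (inr _)).
  by rewrite -!mulr_sumr w1 z1; ring.
- rewrite big_split_ord/= !scaler_sumr.
  congr (_ + _); apply: eq_bigr => i _; rewrite scalerA.
    by rewrite (unsplitK (inl _)).
  by rewrite (unsplitK (inr _)).
Qed.

Lemma convex_hull_polyhedron A s :
  A `<=` polyhedron s -> convex_hull A `<=` polyhedron s.
Proof.
move=> AP _ [n [x [w [Ax w0 w1 ->]]]] c cs; rewrite dot_sumr.
rewrite -[c.2]mul1r -w1 mulr_suml ler_sum// => i _.
by rewrite dotZr ler_wpM2l//; exact: AP.
Qed.

Lemma seq_argmin (T : eqType) (F : T -> R) (r : seq T) a : a \in r ->
  exists2 b, b \in r & forall c, c \in r -> F b <= F c.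
Proof.
elim: r a => // a [_ _ _|d r IHr _ _]; first by exists a;
  rewrite ?mem_head// => c; rewrite inE => /eqP ->.
have [b br bmin] := IHr d (mem_head _ _).
have [ab|ba] := leP (F a) (F b).
  exists a; rewrite ?mem_head// => c; rewrite inE => /predU1P[->//|/bmin].
  exact: le_trans.
exists b; first by rewrite inE br orbT.
by move=> c; rewrite inE => /predU1P[->|/bmin//]; exact: ltW.
Qed.

Lemma count_lt (T : eqType) (a b : pred T) (r : seq T) c :
  (forall d, d \in r -> a d -> b d) -> c \in r -> b c -> ~~ a c ->
  (count a r < count b r)%N.
Proof.
move=> + + bc ac; elim: r => // d r IHr ab.
have ab' e : e \in r -> a e -> b e by move=> er; apply: ab; rewrite inE er orbT.
have ab_d : (a d <= b d)%N by case: (a d) (ab d (mem_head _ _)) => // ->.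
rewrite inE => /predU1P[<-|cr] /=; last by rewrite -addnS leq_add ?IHr.
rewrite bc (negbTE ac) add0n add1n ltnS (@eq_in_count _ a (predI a b)) => [|d' dr].
  by apply: sub_count => d' /andP[].
by rewrite /=; case: (a d') (ab' d' dr) => // ->.
Qed.

(** The sum of the constraints tight at [x] supports the polyhedron; at a point [y] of equality each
    of them is tight, so all of them vanish on [y - x]. *)
Lemma basic_point_vertex s : basic_point s `<=` vertices (polyhedron s).
Proof.
move=> x [xs xu].
pose tight c := dot c.1 x == c.2 :> R.
exists (\sum_(c <- s | tight c) c.1), (\sum_(c <- s | tight c) c.2); split.
  move=> y ys; rewrite dot_suml [leLHS]big_seq_cond [leRHS]big_seq_cond.
  rewrite ler_sum// => c.
  by case/andP => cs _; exact: ys.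
apply/seteqP; split=> [y [ys /eqP]|_ ->]; last first.
  by split=> //=; rewrite dot_suml; apply: eq_bigr => c /eqP.
rewrite dot_suml -subr_eq0 -oppr_eq0 opprB -sumrB big_seq_cond psumr_eq0.
  move=> /allP yt; apply/eqP; rewrite -subr_eq0; apply/eqP/xu => c cs cx.
  have := yt c cs; rewrite cs /tight cx eqxx /= subr_eq0 => /eqP cy.
  by rewrite dotBr -cy cx subrr.
by move=> c /andP[/ys + _]; rewrite subr_ge0.
Qed.

(** There are finitely many patterns of tight constraints, and basic points with the same pattern
    coincide. *)
Lemma basic_point_finite s : finite_set (basic_point s).
Proof.
pose mask x : (size s).-tuple bool :=
  map_tuple (fun c => dot c.1 x == c.2) (in_tuple s).
pose g (t : (size s).-tuple bool) := xget 0 [set x | basic_point s x /\ mask x = t].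
apply: (@sub_finite_set _ _ (range g)); last exact/finite_image/finite_finset.
move=> x xs; exists (mask x) => //.
rewrite /g; case: xgetP => [y _ [[ys yu] yx]|/(_ x)[]//].
apply/eqP; rewrite -subr_eq0; apply/eqP/yu => c cs cy.
have cyx : (dot c.1 y == c.2) = (dot c.1 x == c.2).
  move: yx => /(congr1 val)/= /eq_in_map; exact.
by rewrite dotBr; move: cyx; rewrite cy eqxx => /esym/eqP ->; rewrite subrr.
Qed.

(** * Polyhedra with trivial recession cone *)

Section Pointed.
Variable s : seq ('rV[R]_q * R).
Hypothesis s_noray : forall u, (forall c, c \in s -> dot c.1 u <= 0) -> u = 0.

(** The ratio test: [t] is the least step [F c] at which a constraint increasing along [u] becomes
    tight. Such a constraint exists by [s_noray]. *)
Lemma polyhedron_exit x u : polyhedron s x -> u != 0 -> exists (t : R) c,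
  [/\ 0 <= t, polyhedron s (x + t *: u), c \in s, 0 < dot c.1 u &
      dot c.1 (x + t *: u) = c.2].
Proof.
move=> xs u0; pose F c := (c.2 - dot c.1 x) / dot c.1 u.
have [c0 c0s] : exists c, c \in [seq c <- s | 0 < dot c.1 u].
  apply: contrapT => /forallNP h; move/eqP: u0; apply; apply: s_noray => c cs.
  by rewrite leNgt; apply/negP => cu; apply: (h c); rewrite mem_filter cu.
have [c] := seq_argmin F c0s; rewrite mem_filter => /andP[cu cs] cmin.
have F0 : 0 <= F c by rewrite divr_ge0 ?(ltW cu)// subr_ge0 xs.
exists (F c), c; split=> //.
  move=> d ds; rewrite dotDr dotZr; have [du|ud] := leP (dot d.1 u) 0.
    have : F c * dot d.1 u <= 0 by rewrite mulr_ge0_le0.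
    by have := xs d ds; lra.
  have : F c <= F d by apply: cmin; rewrite mem_filter ud.
  rewrite ler_pdivlMr//; lra.
by rewrite dotDr dotZr divfK ?gt_eqF// addrC subrK.
Qed.

(** Induction on the number of constraints that are not tight. A nonbasic point lies between the
    exit points along [u] and [- u], where [u] preserves the tight constraints, and each exit point
    has a further tight constraint. *)
Lemma polyhedron_hull : polyhedron s = convex_hull (basic_point s).
Proof.
apply/seteqP; split=> [x|]; last by apply: convex_hull_polyhedron => x [].
pose free x := count (fun c => dot c.1 x != c.2) s.
have [n] := ubnP (free x); elim: n x => // n IHn x /ltnSE fx xs.
have [xb|] := pselect (basic_point s x); first exact: convex_hull_sub.
move=> /not_andP[//|/existsNP[u /not_implyP[utight /eqP u0]]].
have step v : v != 0 ->
    (forall c, c \in s -> dot c.1 x = c.2 -> dot c.1 v = 0) ->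
    exists2 t : R, 0 < t & convex_hull (basic_point s) (x + t *: v).
  move=> v0 vtight; have [t [c [t0 xt cs cv cx]]] := polyhedron_exit xs v0.
  have cx' : dot c.1 x != c.2.
    by apply: contraTneq cv => /(vtight c cs) ->; rewrite ltxx.
  exists t.
    rewrite lt_def t0 andbT; apply: contraNneq cx' => t00.
    by move: cx; rewrite t00 scale0r addr0 => ->.
  apply: IHn xt; rewrite (leq_trans _ fx)//.
  apply: (count_lt _ cs cx') => [d ds|]; last by rewrite cx eqxx.
  apply: contraNneq => dx; rewrite dotDr dotZr (vtight d ds dx) mulr0 addr0.
  exact/eqP.
have [t1 t10 xt1] := step u u0 utight.
have [||t2 t20 xt2] := step (- u).
- by rewrite oppr_eq0.
- by move=> c cs cx; rewrite dotNr utight ?oppr0.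
have t12 : 0 < t1 + t2 by rewrite addr_gt0.
have -> : x = (t2 / (t1 + t2)) *: (x + t1 *: u) +
    (1 - t2 / (t1 + t2)) *: (x + t2 *: - u).
  by apply/rowP => i; rewrite !mxE; field; rewrite gt_eqF.
apply: convex_hull_convex => //; first by rewrite divr_ge0 ?ltW.
by rewrite ler_pdivrMr// mul1r lerDr ltW.
Qed.

End Pointed.

Lemma bounded_affine_slope (a b c : R) : (forall t, a + t * b <= c) -> b = 0.
Proof.
move=> h; apply/eqP/negPn/negP => b0.
by have := h ((c - a + 1) / b); rewrite divfK//; lra.
Qed.

(** * Boxes as polyhedra *)

Section Box.
Variable f : 'rV[R]_q.
Implicit Types N : 'M[R]_q.

(** Two constraints per coordinate, the norm being the maximum norm. The value [k = 0] encodes the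
    equations of an affine subspace. *)
Definition box_constraints N (k : R) : seq ('rV[R]_q * R) :=
  [seq ((col i N)^T, dot (col i N)^T f + k) | i <- enum 'I_q] ++
  [seq (- (col i N)^T, k - dot (col i N)^T f) | i <- enum 'I_q].

Lemma dot_col N x i : dot (col i N)^T x = (x *m N) 0 i.
Proof. by rewrite mxE; apply: eq_bigr => j _; rewrite !mxE mulrC. Qed.

Lemma box_constraintsP N (k : R) x : 0 <= k ->
  polyhedron (box_constraints N k) x <-> `|(x - f) *m N| <= k.
Proof.
move=> k0; split=> [xk|xk c].
  apply: normr_row_le => // i; rewrite ler_norml -dot_col dotBr.
  have ci : i \in enum 'I_q by rewrite mem_enum.
  have /(_ _) := xk ((col i N)^T, dot (col i N)^T f + k).
  rewrite mem_cat map_f//= => /(_ isT) h1.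
  have /(_ _) := xk (- (col i N)^T, k - dot (col i N)^T f).
  rewrite mem_cat orbC map_f//= => /(_ isT); rewrite dotNl => h2.
  by apply/andP; split; lra.
have xki i : `|((x - f) *m N) 0 i| <= k by rewrite (le_trans (normr_coord_le _ _)).
rewrite mem_cat => /orP[] /mapP[i _ ->] /=;
  have := xki i; rewrite -dot_col dotBr ler_norml => /andP[h1 h2].
  lra.
rewrite dotNl; lra.
Qed.

Lemma polyhedron_cat (s1 s2 : seq ('rV[R]_q * R)) :
  polyhedron (s1 ++ s2) = polyhedron s1 `&` polyhedron s2.
Proof.
apply/seteqP; split=> [x xs|x [xs1 xs2] c].
  by split=> c cs; apply: xs; rewrite mem_cat cs ?orbT.
by rewrite mem_cat => /orP[/xs1|/xs2].
Qed.

End Box.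

End Polyhedra.

(** * Validity *)

Section Validity.
Variables (R : realType) (q : nat) (f : 'rV[R]_q).
Implicit Types (psi : 'rV[R]_q -> R) (X : seq 'rV[R]_q).

Lemma fsum_seq (V : zmodType) (F : 'rV[R]_q -> V) X : uniq X ->
  (forall x, x \notin X -> F x = 0) ->
  \sum_(x \in [set: 'rV[R]_q]) F x = \sum_(x <- X) F x.
Proof.
move=> uX FX; rewrite [RHS]fsbig_seq//; apply/esym/fsbig_widen => // x [_ /= xX].
by apply: FX; apply/negP.
Qed.

(** A family may repeat a ray, so the weights of equal rays are first added up. *)
Lemma valid_infinite_family psi : valid_infinite f psi ->
  forall (I : finType) (r : I -> 'rV[R]_q) (w : I -> R),
    (forall i, 0 <= w i) -> lattice (f + \sum_i w i *: r i) ->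
    1 <= \sum_i psi (r i) * w i.
Proof.
move=> vpsi I r w w0 wl.
pose s x := \sum_(i | r i == x) w i; pose X := undup (codom r).
have rX i : r i \in X by rewrite mem_undup codom_f.
have sX x : x \notin X -> s x = 0.
  by move=> xX; apply: big1 => i /eqP rx; rewrite -rx rX in xX.
have sumE (V : lmodType R) (G : 'rV[R]_q -> V) :
    \sum_(x \in [set: 'rV[R]_q]) s x *: G x = \sum_i w i *: G (r i).
  rewrite (@fsum_seq _ _ X) ?undup_uniq//; last first.
    by move=> x xX; rewrite sX// scale0r.
  under eq_bigr do rewrite scaler_suml.
  rewrite (exchange_big_dep predT)//=; apply: eq_bigr => i _.
  rewrite -big_filter (@eq_filter _ _ (pred1 (r i))) => [|x]; last exact: eq_sym.
  by rewrite filter_pred1_uniq ?undup_uniq// big_seq1.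
have := vpsi s _; rewrite [X in 1 <= X](_ : _ = \sum_i psi (r i) * w i).
  apply; split.
  - apply: (@sub_finite_set _ _ [set` X]) => // x /=.
    by apply: contra_neqT => /sX.
  - by move=> x; apply: sumr_ge0.
  - by rewrite sumE.
transitivity (\sum_i w i *: (psi (r i) : R^o)).
  by rewrite -sumE; apply: eq_fsbigr => x _; exact: mulrC.
by apply: eq_bigr => i _; exact: mulrC.
Qed.

Lemma family_valid_infinite psi :
  (forall n (r : 'I_n -> 'rV[R]_q) (w : 'I_n -> R),
    (forall i, 0 <= w i) -> lattice (f + \sum_i w i *: r i) ->
    1 <= \sum_i psi (r i) * w i) ->
  valid_infinite f psi.
Proof.
move=> vfam s [/finite_seqP[Y sY] s0].
have uX := undup_uniq Y; set X := undup Y in uX.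
have sX x : x \notin X -> s x = 0.
  rewrite mem_undup => xY; apply: contrapT => sx.
  have : [set r | s r != 0] x by apply/eqP.
  by rewrite sY /= (negbTE xY).
rewrite (@fsum_seq _ _ X)//; last by move=> x /sX ->; rewrite scale0r.
rewrite (@fsum_seq _ _ X)//; last by move=> x /sX ->; rewrite mulr0.
rewrite (big_nth 0) big_mkord [X in 1 <= X](big_nth 0) big_mkord => wl.
exact: (vfam _ (fun i : 'I_(size X) => nth 0 X i) (fun i => s (nth 0 X i))).
Qed.

End Validity.

Lemma valid_convex_hull (R : realType) m (S : set 'rV[R]_m) (g : 'rV[R]_m) :
  valid_inequality (convex_hull S) g <-> valid_inequality S g.
Proof.
split=> [vg s Ss|vg _ [n [x [w [Sx w0 w1 ->]]]]].
  exact/vg/convex_hull_sub.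
rewrite dot_sumr -w1 ler_sum// => i _.
by rewrite dotZr ler_peMr//; exact: vg.
Qed.

Lemma rational_vector_multiple (R : realType) q (u : 'rV[R]_q) :
  rational_vector u -> exists2 d : nat, (0 < d)%N & lattice (d%:R *: u).
Proof.
move=> [w ->]; exists (\prod_i `|denq (w 0%R i)|)%N.
  by rewrite prodn_gt0// => i; rewrite absz_gt0 denq_neq0.
apply/latticeP => i; rewrite !mxE (bigD1 i)//= natrM mulrAC.
apply: rpredM; last exact: rpred_nat.
have -> : `|denq (w 0%R i)|%N%:R = (denq (w 0 i))%:~R :> R.
  by rewrite -[in RHS]absz_denq.
by rewrite /ratr mulrC divfK ?rpred_int// intr_eq0 denq_neq0.
Qed.

(** * Maximal lattice-free convex sets *)

Section MaximalLatticeFree.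
Variables (R : realType) (q : nat) (f : 'rV[R]_q) (B : set 'rV[R]_q).
Hypothesis hB : maximal_lattice_free_convex B.
Hypothesis hf : B° f.
Implicit Types (x y u v w z e r : 'rV[R]_q) (C : set 'rV[R]_q).
Local Notation L := (lineality_space B).
Local Notation P := (B `&` [set f + y | y in orthogonal_complement L]).

Let cB : @convex_set R 'rV[R]_q B. Proof. by case: hB. Qed.

Lemma mlf_nolattice z : lattice z -> ~ B° z.
Proof.
case: hB => _ /seteqP[+ _] _ zl Bz; apply; split; [exact: Bz|exact: zl].
Qed.

Lemma mlf_maximal C : @convex_set R 'rV[R]_q C -> B `<=` C ->
  (forall z, lattice z -> ~ C° z) -> C `<=` B.
Proof.
case: hB => _ _ maxB cC BC Cl; rewrite (maxB C)//.
by apply/seteqP; split=> // z [Cz zl]; exact: (Cl z).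
Qed.

(** Maximality applies to the closure: a lattice point interior to it lies strictly between [f] and
    a further point of the closure, hence is interior to [B]. *)
Lemma mlf_closed x : closure B x -> B x.
Proof.
move: x; apply: mlf_maximal => [||z zl Bz].
- exact: convex_closure.
- exact: subset_closure.
have [e e0 Be] := interior_extend f Bz.
apply: (mlf_nolattice zl).
have e1 : 0 < 1 + e by rewrite ltr_pwDl// ltW.
have -> : z = f + (1 + e)^-1 *: (f + (1 + e) *: (z - f) - f).
  by apply/rowP => i; rewrite !mxE; field; rewrite gt_eqF.
apply: convex_interior_line => //; first by rewrite invr_ge0 ltW.
by rewrite invf_lt1// ltrDl.
Qed.

(* If lattice translations bring every multiple of u arbitrarily close to the
   recession cone of B, then B + Ru is still lattice-free. *)
Lemma almost_recession_lineality u :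
  (forall (t eps : R), 0 < eps -> exists w e,
    [/\ lattice w, forall x, B x -> B (x + e) & `|t *: u + w - e| < eps]) ->
  L u.
Proof.
move=> hu x l Bx.
pose C := [set y | exists (t : R) x, B x /\ y = x + t *: u].
suff : C `<=` B by apply; exists l, x.
apply: mlf_maximal => // [|{x l Bx}x Bx|{x l Bx}z zl Cz].
- apply/convexP => _ _ s s0 s1 [t [y [By ->]]] [t' [y' [By' ->]]].
  exists (s * t + (1 - s) * t'), (s *: y + (1 - s) *: y'); split.
    by move/convexP: cB; apply.
  by apply/rowP => i; rewrite !mxE; ring.
- by exists 0, x; rewrite scale0r addr0.
have [eta eta0 [t [x [Bx xE]]]] := interior_extend f Cz.
have eta1 : 0 < 1 + eta by rewrite ltr_pwDl// ltW.
(* Shrinking towards [f] by the factor [s] brings the point beyond [z] back to [z], so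
   [z = y + (s t) u] with [y] interior to [B]. *)
set s := (1 + eta)^-1; pose y := f + s *: (x - f).
have /interior_ballP[eps eps0 yB] : B° y.
  apply: convex_interior_line => //; first exact: subset_closure.
    by rewrite invr_ge0 ltW.
  by rewrite invf_lt1// ltrDl.
have eps2 : 0 < eps / 2 by rewrite divr_gt0.
have [w [e [wl Be small]]] := hu (s * t) _ eps2.
(* The lattice point [z + w] is close to [y + e], and translation by [e] preserves [B]; so it would
   be interior to [B]. *)
apply: (mlf_nolattice (latticeD zl wl)).
apply/interior_ballP; exists (eps / 2) => // y' y'z.
rewrite -(subrK e y'); apply: Be; apply: yB.
have zE : z = y + (s * t) *: u.
  have : s *: (f + (1 + eta) *: (z - f)) = s *: (x + t *: u) by rewrite xE.
  rewrite /y -scalerA => /rowP h; apply/rowP => i; have := h i.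
  rewrite !mxE => {}h; have -> : z 0 i =
    s * (f 0 i + (1 + eta) * (z 0 i - f 0 i)) + f 0 i - s * f 0 i.
    by rewrite /s; field; rewrite gt_eqF.
  by rewrite h; ring.
have -> : y' - e - y = (y' - (z + w)) + ((s * t) *: u + w - e).
  by rewrite zE; apply/rowP => i; rewrite !mxE; ring.
rewrite (le_lt_trans (ler_normD _ _))//; lra.
Qed.

(** If [w] is a lattice vector near [k u], then [t u + w] is near [(t + k) u], a recession direction
    once [k >= |t|]. *)
Lemma recession_lineality u :
  (forall x (t : R), B x -> 0 <= t -> B (x + t *: u)) -> L u.
Proof.
move=> hu; apply: almost_recession_lineality => t eps eps0.
have [k kt [w wl kw]] := dirichlet u (Num.bound `|t|) eps0.
exists w, ((t + k%:R) *: u); split=> // [x Bx|].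
  apply: hu => //; rewrite -lerBlDl sub0r.
  have := archi_boundP (normr_ge0 t) => /ltW tb.
  rewrite (le_trans _ (_ : (Num.bound `|t|)%:R <= _)) ?ler_nat//.
  by rewrite (le_trans _ tb)// ler_normr lexx orbT.
have -> : t *: u + w - (t + k%:R) *: u = - (k%:R *: u - w).
  by apply/rowP => i; rewrite !mxE; ring.
by rewrite normrN.
Qed.

Lemma lineality0 : L 0.
Proof. by move=> x l; rewrite scaler0 addr0. Qed.

Lemma linealityZ (c : R) u : L u -> L (c *: u).
Proof. by move=> Lu x l Bx; rewrite scalerA; exact: Lu. Qed.

Lemma linealityD u v : L u -> L v -> L (u + v).
Proof.
by move=> Lu Lv x l Bx; rewrite scalerDr addrA; apply: Lv; exact: Lu.
Qed.

Lemma lineality_add u x : L u -> B x -> B (x + u).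
Proof. by move=> /(_ x 1); rewrite scale1r; apply. Qed.

Lemma lineality_neqT : exists u, ~ L u.
Proof.
apply: contrapT => /forallNP LT.
apply: (mlf_nolattice (lattice0 R q)); apply/interior_ballP; exists 1 => // y _.
rewrite -(subrK f y) addrC; apply: lineality_add; last exact: interior_subset.
exact: contrapT.
Qed.

(** The normal is [y - c], where [c] is the point of [B] nearest to [y] in the Euclidean
    distance. *)
Lemma mlf_separation y : ~ B y ->
  exists2 a, a != 0 & forall x, B x -> dot a (x - y) <= 0.
Proof.
move=> By; pose D x := dot (x - y) (x - y).
have normD x : `|x - y| ^+ 2 <= D x.
  have [->|xy] := eqVneq x y; first by rewrite subrr normr0 expr0n dot_ge0.
  have [[i j] nE] : exists ij, mx_norm (x - y) = `|(x - y) ij.1 ij.2|.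
    by apply: mx_norm_neq0; rewrite -[mx_norm _]/(`|x - y|) normr_eq0 subr_eq0.
  rewrite -[`|x - y|]/(mx_norm (x - y)) nE ord1 /= real_normK ?num_real//.
  rewrite /D /dot (bigD1 j)//= expr2 lerDl sumr_ge0// => k _.
  by rewrite -expr2 sqr_ge0.
(* Only points at least as near to [y] as [f] matter; cutting [B] down to a ball that holds them
   makes it compact. *)
pose A := B `&` [set x | `|x - y| <= 1 + D f].
have Df0 : 0 <= D f by exact: dot_ge0.
have sub_ball x : D x <= D f -> `|x - y| <= 1 + D f.
  move=> xf; rewrite leNgt; apply/negP => lt_f.
  have := le_trans (normD x) xf; apply/negP; rewrite -ltNge.
  rewrite (lt_trans _ (_ : (1 + D f) ^+ 2 < _)) ?ltrXn2r ?nnegrE//; nra.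
have cD : continuous D.
  rewrite /D /dot => x.
  elim: (index_enum _) => [|i s IHs].
    rewrite (_ : (fun _ => _) = cst 0); first exact: cst_continuous.
    by apply/funext => u; rewrite big_nil.
  have ci : continuous_at x (fun u : 'rV[R]_q => (u - y) 0 i).
    rewrite (_ : (fun _ => _) = (fun u : 'rV[R]_q => u 0 i - y 0 i)).
      apply: (@continuousB R R^o 'rV[R]_q (fun u => u 0 i)).
        exact: coord_continuous.
      exact: cst_continuous.
    by apply/funext => u; rewrite !mxE.
  rewrite (_ : (fun _ => _) = (fun u : 'rV[R]_q => (u - y) 0 i * (u - y) 0 i +
      \sum_(j <- s) (u - y) 0 j * (u - y) 0 j)).
    apply: (@continuousD R R^o 'rV[R]_q
      (fun u : 'rV[R]_q => (u - y) 0 i * (u - y) 0 i) _ _ _ IHs).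
    exact: continuousM.
  by apply/funext => u; rewrite big_cons.
have cA : compact A.
  apply: bounded_closed_compact.
    exists (1 + D f + `|y|); split=> [|m mb x [_ xy]]; first exact: num_real.
    rewrite /= -(subrK y x) (le_trans (ler_normD _ _))//.
    by rewrite (le_trans _ (ltW mb))// lerD2r.
  move=> x /closure_ballP xA; split.
    apply: mlf_closed; apply/closure_ballP => e e0.
    by have [x' [Bx' _] xx'] := xA e e0; exists x'.
  apply/ler_addgt0Pl => e e0; have [x' [_ x'y] xx'] := xA e e0.
  rewrite -(subrK x' x) -addrA (le_trans (ler_normD _ _))// lerD//.
  by rewrite distrC ltW.
have Af : A f by split; [exact: interior_subset|exact: sub_ball].
have [c /set_mem [Bc _] cmin] :=
  EVT_min_rV (ex_intro _ f Af) cA (continuous_subspaceT cD).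
have cminB x : B x -> D c <= D x.
  move=> Bx; have [xf|fx] := leP (D x) (D f).
    by apply/cmin/mem_set; split=> //; exact: sub_ball.
  by rewrite (le_trans _ (ltW fx))//; apply/cmin/mem_set.
exists (y - c).
  by rewrite subr_eq0; apply: contra_notN By => /eqP ->.
move=> x Bx; set h := dot (c - y) (x - c).
have -> : dot (y - c) (x - y) = - h - dot (c - y) (c - y).
  have -> : x - y = (x - c) + (c - y) by rewrite addrA subrK.
  by rewrite -[y - c]opprB dotNl dotDr opprD.
suff : 0 <= h by have := dot_ge0 (c - y); lra.
rewrite leNgt; apply/negP => h0; set E := dot (x - c) (x - c).
have E0 : 0 <= E by exact: dot_ge0.
have var (s : R) : 0 <= s -> s <= 1 -> 0 <= s * (2 * h + s * E).
  move=> s0 s1; have : D c <= D (s *: x + (1 - s) *: c).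
    by apply: cminB; move/convexP: cB; apply.
  have -> : D (s *: x + (1 - s) *: c) = D c + s * (2 * h + s * E).
    rewrite /D /h /E; have -> : s *: x + (1 - s) *: c - y = (c - y) + s *: (x - c).
      by apply/rowP => i; rewrite !mxE; ring.
    move: (x - c) (c - y) => u v.
    by rewrite !(dotDl, dotDr, dotZl, dotZr) (dotC u v); ring.
  by rewrite lerDl.
(* The step [s = - h / (E - h)] lies between 0 and 1, also when [E = 0], and satisfies [s E <= - h];
   hence [2 h + s E <= h < 0]. *)
have d0 : 0 < E - h by lra.
have s0 : 0 <= - h / (E - h) by rewrite divr_ge0 ?ltW//; lra.
have s1 : - h / (E - h) <= 1 by rewrite ler_pdivrMr// mul1r; lra.
have := var _ s0 s1; apply/negP; rewrite -ltNge.
rewrite pmulr_rlt0 ?divr_gt0 ?oppr_gt0//.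
have : - h / (E - h) * E <= - h.
  rewrite mulrAC ler_pdivrMr// ler_pM2l ?oppr_gt0//; lra.
lra.
Qed.

(** Points just beyond [z] on the ray from [f] lie outside [B] and can be separated from it; a limit
    of the unit normals works for [z]. *)
Lemma mlf_support z : ~ B° z ->
  exists2 a, a != 0 & forall x, B x -> dot a (x - z) <= 0.
Proof.
move=> Bz.
pose Z (n : nat) := f + (1 + n.+1%:R^-1) *: (z - f).
have ZB n : ~ B (Z n).
  move=> BZ; apply: Bz; pose t : R := 1 + n.+1%:R^-1.
  have n0 : 0 < n.+1%:R^-1 :> R by rewrite invr_gt0.
  have t1 : 1 < t by rewrite ltrDl.
  have -> : z = f + t^-1 *: (Z n - f).
    apply/rowP => i; rewrite /Z -/t !mxE; field.
    by rewrite gt_eqF// (lt_trans ltr01).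
  apply: convex_interior_line => //; first exact: subset_closure.
    by rewrite invr_ge0 ltW// (lt_trans ltr01).
  by rewrite invf_lt1// (lt_trans ltr01).
have : forall n, exists a, a != 0 /\ forall x, B x -> dot a (x - Z n) <= 0.
  by move=> n; have [a a0 aP] := mlf_separation (ZB n); exists a.
move=> /choice[a aP].
have a0 n : a n != 0 by case: (aP n).
have [l l1 lP] := unit_cluster a0.
exists l; first by rewrite -normr_gt0 l1.
move=> x Bx; apply/ler_addgt0Pl => e e0; rewrite addr0.
pose X := q%:R * `|x - z| + q%:R * `|z - f|.
have X0 : 0 <= X by rewrite addr_ge0// mulr_ge0.
have X1 : 0 < X + 1 by lra.
have eX : 0 < e / (X + 1) by rewrite divr_gt0.
have [n nN nl] := lP _ (Num.bound (e / (X + 1))^-1) eX.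
set u := `|a n|^-1 *: a n in nl.
have u1 : `|u| = 1 by rewrite normrZ normfV normr_id mulVf// normr_eq0.
have uZ : dot u (x - Z n) <= 0.
  by rewrite dotZl pmulr_rle0 ?invr_gt0 ?normr_gt0//; case: (aP n) => _; apply.
have ne : n.+1%:R^-1 <= e / (X + 1).
  rewrite -[leRHS]invrK lef_pV2 ?posrE ?invr_gt0//.
  rewrite (le_trans (ltW (archi_boundP _))) ?invr_ge0 ?(ltW eX)//.
  by rewrite ler_nat leqW.
have -> : dot l (x - z) =
    dot u (x - Z n) - dot (u - l) (x - z) + n.+1%:R^-1 * dot u (z - f).
  have -> : x - Z n = (x - z) - n.+1%:R^-1 *: (z - f).
    by apply/rowP => i; rewrite !mxE; ring.
  by move: (x - z) (z - f) => p r; rewrite !(dotBr, dotBl, dotZr); ring.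
have h1 : - dot (u - l) (x - z) <= e / (X + 1) * (q%:R * `|x - z|).
  rewrite (le_trans (ler_norm _))// normrN (le_trans (normr_dot_le _ _))//.
  by rewrite mulrAC [leRHS]mulrC ler_wpM2l ?mulr_ge0// ltW.
have h2 : n.+1%:R^-1 * dot u (z - f) <= e / (X + 1) * (q%:R * `|z - f|).
  apply: (@le_trans _ _ (n.+1%:R^-1 * (q%:R * `|z - f|))).
    rewrite ler_wpM2l ?invr_ge0// (le_trans (ler_norm _))//.
    by rewrite (le_trans (normr_dot_le _ _))// u1 mulr1.
  by rewrite ler_wpM2r// mulr_ge0.
have eX' : e / (X + 1) * X <= e by rewrite mulrAC ler_pdivrMr// ler_pM2l//; lra.
apply: le_trans eX'; have := lerD uZ (lerD h1 h2).
by rewrite -mulrDr add0r addrA.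
Qed.

(* M is the matrix of the orthogonal projection along L. *)
Section Projection.
Variable W : {vspace 'rV[R]_q}.
Hypothesis LW : L = [set x | x \in W].
Variable M : 'M[R]_q.
Hypothesis MW : forall x u, u \in W -> dot u (x *m M) = 0.
Hypothesis subMW : forall x, x - x *m M \in W.
Hypothesis M0 : forall x, x \in W -> x *m M = 0.
Hypothesis M1 :
  forall y, (forall u, u \in W -> dot u y = 0) -> y *m M = y.

Let Lin x : x \in W -> L x. Proof. by rewrite LW. Qed.
Let inL x : L x -> x \in W. Proof. by rewrite LW. Qed.

(** Otherwise nonzero projections of lattice vectors tend to zero, with a limit direction [l].
    Modulo [L], integer multiples of these vectors come close to every multiple of [l], so [l] lies
    in [L]; but it is a unit vector orthogonal to [L]. *)
Lemma projection_lattice_discrete :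
  exists2 d : R, 0 < d & forall z, lattice z -> `|z *m M| < d -> z \in W.
Proof.
apply: contrapT => hd.
have : forall n : nat, exists z,
    [/\ lattice z, `|z *m M| < n.+1%:R^-1 & z \notin W].
  move=> n; apply: contrapT => /forallNP hz; apply: hd.
  exists n.+1%:R^-1; first by rewrite invr_gt0.
  move=> z zl zM; apply: contrapT => /negP zW; apply: (hz z); by split.
move=> /choice[z zP].
have zM0 n : z n *m M != 0.
  have [_ _] := zP n; apply: contra => /eqP zM.
  by rewrite -[z n]subr0 -zM.
have [l l1 lP] := unit_cluster zM0.
have lM : l *m M = l.
  apply: mulmx_fixed_closed => e e0; have [n _ ne] := lP e 0%N e0.
  exists (`|z n *m M|^-1 *: (z n *m M)) => //.
  by rewrite -scalemxAl (M1 (MW (z n))).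
suff /inL/M0 : L l.
  by rewrite lM => l0; move: l1; rewrite l0 normr0 => /eqP; rewrite eq_sym oner_eq0.
apply: almost_recession_lineality => t eps eps0.
have eps2 : 0 < eps / 2 by rewrite divr_gt0.
have t1 : 0 < `|t| + 1 by rewrite ltr_wpDl.
have [n nN nl] := lP (eps / 2 / (`|t| + 1)) (Num.bound (eps / 2)^-1)
  (divr_gt0 eps2 t1).
have [znl znN _] := zP n.
set y := z n *m M in nl znN *.
have y0 : 0 < `|y| by rewrite normr_gt0 zM0.
have ye : `|y| < eps / 2.
  rewrite (lt_trans znN)// -[ltRHS]invrK ltf_pV2 ?posrE ?invr_gt0//.
  rewrite (lt_le_trans (archi_boundP _)) ?invr_ge0 ?(ltW eps2)//.
  by rewrite ler_nat leqW.
(* The multiple [m y] approximates [t l]: rounding costs at most [|y|], and the deviation of the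
   direction of [y] from [l] costs at most [eps / 2]. *)
set m : R := (Num.floor (t / `|y|))%:~R.
exists (- m *: z n), (- m *: (z n - y)); split.
- by apply: latticeZ => //; rewrite rpredN intr_int.
- by move=> x; apply/lineality_add/Lin; rewrite memvZ.
have -> : t *: l + - m *: z n - - m *: (z n - y) =
    t *: (l - `|y|^-1 *: y) + (t - m * `|y|) *: (`|y|^-1 *: y).
  by apply/rowP => i; rewrite !mxE; field; rewrite gt_eqF.
have nu1 : `| `|y|^-1 *: y| = 1.
  by rewrite normrZ gtr0_norm ?invr_gt0// mulVf// gt_eqF.
rewrite (le_lt_trans (ler_normD _ _))// (normrZ t) (normrZ (t - _)) nu1 mulr1.
have : `|t - m * `|y| | <= `|y|.
  have := real_floor_itv (num_real (t / `|y|)).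
  rewrite intrD -/m ler_pdivlMr// ltr_pdivrMr// => /andP[h1 h2].
  rewrite ger0_norm; lra.
have : `|t| * `|l - `|y|^-1 *: y| <= eps / 2.
  rewrite distrC (le_trans (ler_wpM2l (normr_ge0 t) (ltW nl)))//.
  rewrite mulrC mulrAC ler_pdivrMr// ler_pM2l// lerDl//.
lra.
Qed.

(** For [l] in [L], some lattice vector [w] is near a multiple [k l]. Its projection along [L] is
    small, so [w] lies in [L] by discreteness, hence in the span [S] of the lattice vectors of [L].
    Thus [l] is arbitrarily close to [S]. *)
Lemma lineality_rational : rational_space L.
Proof.
rewrite /rational_space; set A := L `&` lattice (q := q).
apply/seteqP; split=> [l Ll|x [X XA xX]]; last first.
  apply: Lin; have /subvP : (<<X>> <= W)%VS; last exact.
  by apply/span_subvP => u /XA [/inL].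
have [S AS] : exists S : {vspace 'rV[R]_q}, linear_span A = [set x | x \in S].
  apply: subspace_vspace.
  - by exists [::]; rewrite ?mem0v.
  - move=> x y [X XA xX] [Y YA yY]; exists (X ++ Y).
      by move=> u; rewrite mem_cat => /orP[/XA|/YA].
    by rewrite span_cat memv_add.
  - by move=> c x [X XA xX]; exists X => //; exact: memvZ.
rewrite AS /=.
have SA w : A w -> w \in S.
  move=> Aw; have : linear_span A w; last by rewrite AS.
  exists [:: w]; last by rewrite memv_span ?mem_head.
  by move=> u; rewrite inE => /eqP ->.
have [N [_ subN N0 _]] := orthogonal_projection S.
suff lN : l *m N = 0 by rewrite -[l]subr0 -lN.
have [c c0 cM] := normr_mulmx_le M; have [c' c'0 cN] := normr_mulmx_le N.
have [d d0 dM] := projection_lattice_discrete.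
apply/eqP; rewrite -normr_eq0 eq_le normr_ge0 andbT.
apply/ler_addgt0Pl => e e0; rewrite addr0.
(* The bound [d / c] puts [w] in [L]; [e / c'] controls the distance to [S]. Below, [k >= 1] ensures
   that dividing by [k] does no harm. *)
have eps0 : 0 < Num.min (e / c') (d / c) by rewrite lt_min !divr_gt0.
have [k k1 [w wl]] := dirichlet l 1 eps0.
rewrite lt_min => /andP[kw1 kw2].
have k0 : 0 < k%:R :> R by rewrite ltr0n.
have wS : w \in S.
  apply: SA; split=> //; apply/Lin/dM => //.
  have -> : w *m M = - ((k%:R *: l - w) *m M).
    by rewrite mulmxBl -scalemxAl (M0 (inL Ll)) scaler0 sub0r opprK.
  by rewrite normrN (le_lt_trans (cM _))// mulrC -ltr_pdivlMr.
have : `|k%:R *: (l *m N)| <= e.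
  have -> : k%:R *: (l *m N) = (k%:R *: l - w) *m N.
    by rewrite mulmxBl (N0 w)// subr0 scalemxAl.
  by rewrite (le_trans (cN _))// mulrC -ler_pdivlMr// ltW.
rewrite normrZ gtr0_norm//; apply: le_trans.
by rewrite ler_peMl// ler1n.
Qed.

Lemma subMB x : B x -> B (f + (x - f) *m M).
Proof.
move=> Bx; have -> : f + (x - f) *m M = x - (x - f - (x - f) *m M).
  by apply/rowP => i; rewrite !mxE; ring.
by apply: lineality_add => //; apply: Lin; rewrite rpredN.
Qed.

(** Otherwise the directions of unbounded projected points have a limit [l]. As [B] is closed and
    convex, [l] is a recession direction, hence in [L]; but it is a unit vector orthogonal to
    [L]. *)
Lemma projection_bounded :
  exists2 K : R, 0 < K & forall x, B x -> `|(x - f) *m M| <= K.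
Proof.
apply: contrapT => hK.
have : forall n : nat, exists x, B x /\ n.+1%:R < `|(x - f) *m M|.
  move=> n; apply: contrapT => /forallNP hx; apply: hK.
  exists n.+1%:R => // x Bx; rewrite leNgt; apply/negP => xn.
  by apply: (hx x).
move=> /choice[X XP]; pose y n := (X n - f) *m M.
have yn n : n.+1%:R < `|y n| by case: (XP n).
have y0 n : y n != 0 by rewrite -normr_gt0 (le_lt_trans _ (yn n)).
have [l l1 lP] := unit_cluster y0.
have lM : l *m M = l.
  apply: mulmx_fixed_closed => e e0; have [n _ ne] := lP e 0%N e0.
  by exists (`|y n|^-1 *: y n); rewrite // -scalemxAl (M1 (MW (X n - f))).
suff /inL/M0 : L l.
  by rewrite lM => l0; move: l1; rewrite l0 normr0 => /eqP; rewrite eq_sym oner_eq0.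
apply: recession_lineality => x t Bx t0.
apply: mlf_closed; apply/closure_ballP => e e0.
have t1 : 0 < t + 1 by rewrite ltr_wpDl.
have e2 : 0 < e / 2 by rewrite divr_gt0.
(* Once [|y n|] exceeds [b], the weight [t / |y n|] is at most 1 and contributes an error below
   [e / 2]. *)
pose b := t + t * `|f - x| / (e / 2).
have b0 : 0 <= b by rewrite addr_ge0// divr_ge0 ?mulr_ge0// ltW.
have [n nb nl] := lP (e / 2 / (t + 1)) (Num.bound b) (divr_gt0 e2 t1).
have yb : b < `|y n|.
  rewrite (lt_trans (archi_boundP b0))// (le_lt_trans _ (yn n))//.
  by rewrite ler_nat leqW.
have yn0 : 0 < `|y n| by exact: le_lt_trans yb.
exists (t / `|y n| *: (f + y n) + (1 - t / `|y n|) *: x).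
  move/convexP: cB; apply => //; last 1 first.
  - by apply: subMB; case: (XP n).
  - by rewrite divr_ge0.
  - rewrite ler_pdivrMr// mul1r (le_trans _ (ltW yb))// lerDl.
    by rewrite divr_ge0 ?mulr_ge0// ltW.
have -> : t / `|y n| *: (f + y n) + (1 - t / `|y n|) *: x - (x + t *: l) =
    t *: (`|y n|^-1 *: y n - l) + (t / `|y n|) *: (f - x).
  by apply/rowP => i; rewrite !mxE; field; rewrite gt_eqF.
rewrite (le_lt_trans (ler_normD _ _))// (normrZ t) (normrZ (t / _)).
rewrite !ger0_norm ?divr_ge0//.
have : t / `|y n| * `|f - x| < e / 2.
  rewrite mulrAC ltr_pdivrMr// [ltRHS]mulrC -ltr_pdivrMr// (le_lt_trans _ yb)//.
  by rewrite lerDr.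
have : t * `| `|y n|^-1 *: y n - l| <= e / 2.
  rewrite (le_trans (ler_wpM2l t0 (ltW nl)))//.
  rewrite mulrC mulrAC ler_pdivrMr// ler_pM2l// lerDl//.
lra.
Qed.

(** Infinitely many bounded projections would include two distinct ones at distance less than [d],
    against discreteness. *)
Lemma projection_lattice_finite (K : R) :
  finite_set [set z *m M | z in [set z | lattice z /\ `|(z - f) *m M| <= K]].
Proof.
have [d d0 dM] := projection_lattice_discrete.
set F := (X in finite_set X).
apply: contrapT => /infiniteP/pcard_leP[g].
have gF n : F (g n) by exact: funS.
have gM n : `|g n| <= K + `|f *m M|.
  have [z [_ zK] <-] := gF n.
  rewrite -(subrK f z) mulmxDl (le_trans (ler_normD _ _))//.
  by rewrite lerD2r.
have [l lP] := bolzano_weierstrass gM.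
have d2 : 0 < d / 2 by rewrite divr_gt0.
have [n _ nl] := lP _ 0%N d2; have [m nm ml] := lP _ n.+1 d2.
suff /inj : g m = g n by rewrite !in_setT => /(_ isT isT) mn; rewrite mn ltnn in nm.
have [z [zl _] zE] := gF n; have [z' [z'l _] z'E] := gF m.
apply/eqP; rewrite -zE -z'E -subr_eq0 -mulmxBl; apply/eqP/M0/dM.
  exact: latticeB.
rewrite mulmxBl zE z'E -(subrK l (g m)) -addrA (le_lt_trans (ler_normD _ _))//.
rewrite (distrC l); lra.
Qed.

(* B lies in the polyhedron cut out by a bound on the projection and, for each
   of the finitely many projected lattice points within that bound, a
   halfspace through it; maximality makes the inclusion an equality. *)
Lemma mlf_polyhedron : exists s, B = polyhedron s.
Proof.
have [K K0 KB] := projection_bounded.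
have := projection_lattice_finite K.
move=> /finite_seqP[F FE].
have : forall p, exists c : 'rV[R]_q * R, p \in F ->
    [/\ c.1 != 0, forall x, B x -> dot c.1 x <= c.2 &
        exists2 z, z *m M = p & dot c.1 z = c.2].
  move=> p; have [pF|] := boolP (p \in F); last by exists (0, 0).
  have : [set` F] p by [].
  rewrite -FE => -[z [zl _] zp].
  have [a a0 aP] := mlf_support (mlf_nolattice zl).
  exists (a, dot a z) => _; split=> //; last by exists z.
  by move=> x /aP /=; rewrite dotBr subr_le0.
move=> /choice[C CP].
exists (box_constraints f M K ++ [seq C p | p <- F]).
have BQ : B `<=` polyhedron (box_constraints f M K ++ [seq C p | p <- F]).
  move=> x Bx; rewrite polyhedron_cat; split.
    by apply/box_constraintsP; [exact: ltW|exact: KB].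
  by move=> _ /mapP[p pF ->]; have [_ + _] := CP p pF; apply.
apply/seteqP; split=> //.
apply: mlf_maximal => [|//|z zl Qz].
  exact: polyhedron_convex.
have := interior_subset Qz; rewrite polyhedron_cat => -[/box_constraintsP].
move=> /(_ (ltW K0)) zK _.
have zF : z *m M \in F.
  have : [set` F] (z *m M) by rewrite -FE; exists z.
  by [].
have [a0 aB [z' z'M az']] := CP _ zF.
set c := C (z *m M) in a0 aB az'.
(* The normal vanishes on [L], so the hyperplane through [z'] also passes through [z], which has the
   same projection. *)
have aW w : w \in W -> dot c.1 w = 0.
  move=> wW; apply: (@bounded_affine_slope _ (dot c.1 f) _ c.2) => t.
  rewrite -dotZr -dotDr; apply: aB; apply: (Lin wW).
  exact: interior_subset.
have az : dot c.1 z = c.2.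
  have := subMW (z - z'); rewrite mulmxBl z'M subrr subr0 => /aW.
  by rewrite dotBr az' => /eqP; rewrite subr_eq0 => /eqP.
(* Extending from [z - c.1] through [z] gives [z + e c.1], which violates the constraint [c]. *)
have [e e0 Qe] := interior_extend (z - c.1) Qz.
have : dot c.1 (z - c.1 + (1 + e) *: (z - (z - c.1))) <= c.2.
  by apply: Qe; rewrite mem_cat map_f ?orbT.
rewrite subKr scalerDl scale1r addrA subrK dotDr dotZr az gerDl.
by apply/negP; rewrite -ltNge mulr_gt0// dot_gt0.
Qed.

(** A box of size 0 for [1%:M - M] supplies the equations of the slice. A recession direction of the
    slice lies in [L] and is orthogonal to it, hence is zero. *)
Lemma orthogonal_slice_polyhedron : exists2 s, P = polyhedron s &
  forall u, (forall c, c \in s -> dot c.1 u <= 0) -> u = 0.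
Proof.
have [s Bs] := mlf_polyhedron.
exists (s ++ box_constraints f (1%:M - M) 0).
  rewrite polyhedron_cat -Bs; congr (_ `&` _).
  apply/seteqP; split=> [_ [y Ly <-]|x].
    apply/box_constraintsP => //; rewrite addrC addKr mulmxBr mulmx1 M1.
      by rewrite subrr normr0.
    by move=> u /Lin; exact: Ly.
  move=> /box_constraintsP => /(_ (lexx 0)); rewrite normr_le0 mulmxBr mulmx1.
  rewrite subr_eq0 => /eqP xM; exists (x - f); last by rewrite addrC subrK.
  by move=> u /inL uW; rewrite xM MW.
move=> u us.
have /inL uW : L u.
  apply: recession_lineality => x t; rewrite Bs => xs t0 c cs.
  rewrite dotDr dotZr (le_trans _ (xs c cs))// gerDl mulr_ge0_le0// us//.
  by rewrite mem_cat cs.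
have uM : `|(u + f - f) *m (1%:M - M)| <= 0.
  apply/box_constraintsP => // c cs; rewrite dotDr.
  have : dot c.1 u <= 0 by apply: us; rewrite mem_cat cs orbT.
  have : polyhedron (box_constraints f (1%:M - M) 0) f.
    by apply/box_constraintsP; rewrite // subrr mul0mx normr0.
  move=> /(_ c cs); lra.
move: uM; rewrite addrK normr_le0 mulmxBr mulmx1 M0// subr0 => /eqP //.
Qed.

Lemma orthogonal_slice_decomposition : B = [set p + l | p in P & l in L].
Proof.
apply/seteqP; split=> [x Bx|_ [p [Bp _]] [l Ll] <-]; last first.
  exact: lineality_add.
exists (f + (x - f) *m M).
  split; first exact: subMB.
  by exists ((x - f) *m M) => // u /inL uW; exact: MW.
exists (x - f - (x - f) *m M); first by apply: Lin.
by apply/rowP => i; rewrite !mxE; ring.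
Qed.

End Projection.

(** [A] is asserted to consist of vertices so that its points can be named by any enumeration of
    [vertices P]. *)
Lemma mlf_structure : [/\ B = [set p + l | p in P & l in L],
  rational_space L &
  exists A, [/\ finite_set A, A `<=` vertices P & P = convex_hull A]].
Proof.
have [W LW] : exists W : {vspace 'rV[R]_q}, L = [set x | x \in W].
  apply: subspace_vspace; [exact: lineality0|exact: linealityD|].
  exact: linealityZ.
have [M [MW subMW M0 M1]] := orthogonal_projection W.
split.
- exact: (orthogonal_slice_decomposition LW MW subMW).
- exact: (lineality_rational LW MW subMW M0 M1).
have [s Ps s_noray] := orthogonal_slice_polyhedron LW MW subMW M0 M1.
exists (basic_point s); split; first exact: basic_point_finite.
  by rewrite Ps; exact: basic_point_vertex.
by rewrite Ps; exact: polyhedron_hull.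
Qed.

(** * Extreme inequalities *)

Section Gauge.
Variables (t : nat) (a : 'I_t.+1 -> 'rV[R]_q).
Hypothesis Ba : B = [set x | forall i, dot (a i) (x - f) <= 1].
Implicit Types c : R.
Local Notation psi := (psi_of a).

Lemma psi_leP r c : psi r <= c <-> forall i, dot (a i) r <= c.
Proof.
split=> [/bigmax_leP[_ h] i|h]; first exact: h.
by apply/bigmax_leP; split.
Qed.

Lemma dot_psi_le i r : dot (a i) r <= psi r.
Proof. by move: i; apply/psi_leP. Qed.

Lemma psi_scale c r : 0 <= c -> psi (c *: r) <= c * psi r.
Proof.
by move=> c0; apply/psi_leP => i; rewrite dotZr ler_wpM2l// dot_psi_le.
Qed.

Lemma psi_add r x : psi (r + x) <= psi r + psi x.
Proof. by apply/psi_leP => i; rewrite dotDr lerD// dot_psi_le. Qed.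

Lemma psi_sum (I : finType) (r : I -> 'rV[R]_q) (w : I -> R) :
  (forall i, 0 <= w i) -> psi (\sum_i w i *: r i) <= \sum_i psi (r i) * w i.
Proof.
move=> w0; apply/psi_leP => j; rewrite dot_sumr ler_sum// => i _.
by rewrite dotZr mulrC ler_wpM2r// dot_psi_le.
Qed.

Lemma mem_psi x : B x <-> psi (x - f) <= 1.
Proof. by rewrite Ba; apply: iff_sym; exact: psi_leP. Qed.

(** If [psi (z - f) < 1], the common Lipschitz bound [S + 1] of the forms yields a ball around [z]
    inside [B]. *)
Lemma psi_lattice z : lattice z -> 1 <= psi (z - f).
Proof.
move=> zl; rewrite leNgt; apply/negP => z1; apply: (mlf_nolattice zl).
apply/interior_ballP.
pose S := \sum_i (q%:R * `|a i|).
have S0 : 0 <= S by rewrite sumr_ge0// => i _; rewrite mulr_ge0.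
have S1 : 0 < S + 1 by rewrite ltr_wpDl.
exists ((1 - psi (z - f)) / (S + 1)); first by rewrite divr_gt0// subr_gt0.
move=> y yz; rewrite Ba => i.
have -> : y - f = (z - f) + (y - z) by apply/rowP => j; rewrite !mxE; ring.
rewrite dotDr; have h1 := dot_psi_le i (z - f).
have : dot (a i) (y - z) <= (S + 1) * `|y - z|.
  rewrite (le_trans (ler_norm _))// (le_trans (normr_dot_le _ _))//.
  rewrite ler_wpM2r// /S (bigD1 i)//= -addrA lerDl addr_ge0// sumr_ge0//.
move: yz; rewrite ltr_pdivlMr// [_ * (S + 1)]mulrC; lra.
Qed.

Lemma lineality_dot i u : L u -> dot (a i) u = 0.
Proof.
move=> Lu; apply: (@bounded_affine_slope _ 0 _ 1) => s; rewrite add0r -dotZr.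
have := Lu f s (interior_subset hf); rewrite Ba => /(_ i).
by rewrite addrC addKr.
Qed.

(** If no form [dot (a i)] is positive at [u], then [u] is a recession direction of [B], hence in
    [L]. *)
Lemma psi_lineality u : L u <-> psi u <= 0.
Proof.
split=> [Lu|u0]; first by apply/psi_leP => i; rewrite lineality_dot.
apply: recession_lineality => x c + c0; rewrite Ba => Bx i.
rewrite addrAC dotDr dotZr (le_trans _ (Bx i))// gerDl mulr_ge0_le0//.
exact: le_trans (dot_psi_le i u) u0.
Qed.

Lemma psi_ge0 r : 0 <= psi r.
Proof.
rewrite leNgt; apply/negP => r0; have /psi_lineality Lr := ltW r0.
by have := dot_psi_le ord0 r; rewrite lineality_dot// leNgt r0.
Qed.

Lemma psi_valid : valid_infinite f psi.
Proof.
apply: family_valid_infinite => n r w w0 /psi_lattice; rewrite addrC addKr.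
by move=> /le_trans; apply; exact: psi_sum.
Qed.

(* If psi could be lowered at r0 to some c with 0 < c < psi r0, the convex hull
   of B and f + r0 / c would be a larger lattice-free set. *)
Lemma psi_minimal r0 c :
  (forall s x, 0 <= s -> lattice (f + s *: r0 + x) -> 1 <= c * s + psi x) ->
  psi r0 <= c.
Proof.
move=> hc; rewrite leNgt; apply/negP => c_lt.
(* For [r0] in [L], [c] is negative: reaching the lattice point 0 with [s = psi (- f) / - c] and
   [x = - f - s r0] costs at most 0. *)
have [/psi_lineality Lr|r00] := leP (psi r0) 0.
  have c0 : c < 0.
    by rewrite (lt_le_trans c_lt)//; apply/psi_lineality.
  have s0 : 0 <= psi (- f) / - c by rewrite divr_ge0 ?psi_ge0// oppr_ge0 ltW.
  have := hc (psi (- f) / - c) (- f + (psi (- f) / - c) *: - r0) s0.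
  have -> : f + (psi (- f) / - c) *: r0 + (- f + (psi (- f) / - c) *: - r0) = 0.
    by apply/rowP => i; rewrite !mxE; ring.
  move=> /(_ (lattice0 _ _)); apply/negP; rewrite -ltNge.
  have LNr : L (- r0) by rewrite -scaleN1r; exact: linealityZ.
  have h1 := psi_scale (- r0) s0.
  have := psi_add (- f) ((psi (- f) / - c) *: - r0).
  have := psi_lineality (- r0); case=> /(_ LNr) h2 _.
  have h3 := mulr_ge0_le0 s0 h2.
  have -> : c * (psi (- f) / - c) = - psi (- f) by field; rewrite lt_eqF.
  lra.
(* Averaging with [Num.max c 0] makes [c'] positive, so that [r0] can be divided by it. *)
pose c' := (Num.max c 0 + psi r0) / 2.
have cM : Num.max c 0 < psi r0 by rewrite gt_max c_lt.
have cc' : c <= c'.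
  have : c <= Num.max c 0 by rewrite le_max lexx.
  rewrite /c'; lra.
have c'0 : 0 < c'.
  have : 0 <= Num.max c 0 by rewrite le_max lexx orbT.
  rewrite /c'; lra.
have c'r : c' < psi r0 by rewrite /c'; lra.
pose p := f + c'^-1 *: r0.
suff /(_ p (convex_hull_sub (or_intror erefl))) :
    convex_hull (B `|` [set p]) `<=` B.
  move=> /mem_psi; rewrite addrC addKr => pr.
  have := psi_scale (c'^-1 *: r0) (ltW c'0).
  rewrite scalerA divff ?gt_eqF// scale1r.
  have : c' * psi (c'^-1 *: r0) <= c' * 1 by rewrite ler_pM2l.
  lra.
apply: mlf_maximal => [|x Bx|z zl Cz].
- by apply/convexP => *; exact: convex_hull_convex.
- by apply: convex_hull_sub; left.
have [e e0 [n [x [w [Ax w0 w1 zE]]]]] := interior_extend f Cz.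
have e1 : 0 < 1 + e by rewrite ltr_pwDl// ltW.
pose inB i := `[< B (x i) >].
(* Shrinking by [1 + e] gives [z = f + m r0 + y], where [m] comes from the weight on [p] and [y]
   from that on [B]. The cost is at most [(1 + e)^-1 < 1]. *)
pose m := (\sum_(i | ~~ inB i) w i) / (c' * (1 + e)).
pose y := (1 + e)^-1 *: \sum_(i | inB i) w i *: (x i - f).
have m0 : 0 <= m by rewrite divr_ge0 ?sumr_ge0// mulr_ge0 ?ltW.
have zE' : z = f + m *: r0 + y.
  have : (1 + e) *: (z - f) = \sum_i w i *: (x i - f).
    under eq_bigr do rewrite scalerBr.
    by rewrite sumrB -scaler_suml w1 scale1r -zE [RHS]addrC addKr.
  have xE i : ~~ inB i -> x i - f = c'^-1 *: r0.
    move=> /asboolP Bxi; case: (Ax i) => // ->.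
    by rewrite /p addrC addKr.
  rewrite (bigID inB)/=; under [X in _ = _ + X]eq_bigr => i Bi do rewrite (xE i Bi).
  rewrite -scaler_suml /y => h.
  have -> : z = f + (1 + e)^-1 *: ((1 + e) *: (z - f)).
    by rewrite scalerA mulVf ?gt_eqF// scale1r addrC subrK.
  rewrite h scalerDr -addrA [m *: r0 + _]addrC; congr (_ + (_ + _)).
  by rewrite !scalerA /m; congr (_ *: _); field; rewrite !gt_eqF.
have := hc m y m0; rewrite -zE' => /(_ zl).
apply/negP; rewrite -ltNge.
have h1 : c * m <= c' * m by rewrite ler_wpM2r.
have h2 : psi y <= (1 + e)^-1 * \sum_(i | inB i) w i.
  have e1' : 0 <= (1 + e)^-1 by rewrite invr_ge0 ltW.
  rewrite (le_trans (psi_scale _ e1'))// ler_wpM2l//.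
  apply/psi_leP => j; rewrite dot_sumr ler_sum// => i /asboolP /mem_psi Bxi.
  by rewrite dotZr ler_piMr// (le_trans (dot_psi_le _ _)).
have h3 : c' * m + (1 + e)^-1 * \sum_(i | inB i) w i = (1 + e)^-1.
  have wS : \sum_(i | inB i) w i + \sum_(i | ~~ inB i) w i = 1.
    by rewrite -w1 [RHS](bigID inB).
  rewrite -[RHS]mulr1 -[X in _ = _ * X]wS /m; field.
  by rewrite !gt_eqF.
have : (1 + e)^-1 < 1 by rewrite invf_lt1// ltrDl.
lra.
Qed.

(** * Vertices, ray decompositions and the finite inequality *)

Variables (k h : nat) (v : 'I_k -> 'rV[R]_q) (b : 'I_h -> 'rV[R]_q).
Hypothesis v_inj : injective v.
Hypothesis v_vertices : range v = vertices P.
Hypothesis Lb : rational_basis L b.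
Local Notation rays := (rays f v b).

Lemma lineality_span : L = [set x | x \in <<[seq b j | j <- enum 'I_h]>>%VS].
Proof. by case: Lb. Qed.

Lemma basis_lineality i : L (b i).
Proof. by rewrite lineality_span /= memv_span// map_f ?mem_enum. Qed.

Lemma lineality_coord u : L u -> exists m : 'I_h -> R, u = \sum_i m i *: b i.
Proof.
rewrite lineality_span /= => uL; pose X := [tuple b j | j < h].
have uX : u \in <<X>>%VS by [].
exists (fun i => coord X i u); rewrite [LHS](coord_span uX).
by apply: eq_bigr => i _; rewrite (nth_map i) ?size_enum_ord// nth_ord_enum.
Qed.

Lemma lineality_sum (m : 'I_h -> R) : L (\sum_i m i *: b i).
Proof.
elim/big_ind: _ => [|x y|i _]; [exact: lineality0|exact: linealityD|].
by apply: linealityZ; exact: basis_lineality.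
Qed.

(** If the value were below 1, [v j] could be moved inside [P] both ways along a nonzero [u]
    orthogonal to [L], so no linear form would expose it. Such a [u] exists because [L] is not the
    whole space. *)
Lemma psi_vertex j : psi (v j - f) = 1.
Proof.
have [c [d [cd vE]]] : vertices P (v j) by rewrite -v_vertices; exists j.
have [[Bv [w Lw wv]] cv] : (P `&` [set x | dot c x = d]) (v j) by rewrite vE.
apply/eqP; rewrite eq_le; apply/andP; split; first exact/mem_psi.
rewrite leNgt; apply/negP => v1.
have [M [MW subMW M0 _]] :=
  orthogonal_projection <<[seq b j | j <- enum 'I_h]>>%VS.
have [u0 Lu0] := lineality_neqT.
pose u := u0 *m M.
have u_neq0 : u != 0.
  apply/eqP => u00; apply: Lu0; rewrite lineality_span /=.
  by have := subMW u0; rewrite -/u u00 subr0.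
have psi0 := psi_ge0.
have e0 : 0 < 1 + psi u + psi (- u) by rewrite -addrA ltr_pwDl// addr_ge0.
(* The denominator exceeds both [psi u] and [psi (- u)], so one step length serves both
   directions. *)
pose e := (1 - psi (v j - f)) / (1 + psi u + psi (- u)).
have e_gt0 : 0 < e by rewrite divr_gt0// subr_gt0.
have Pv y : (forall u', L u' -> dot u' y = 0) -> e * psi y <= 1 - psi (v j - f) ->
    P (v j + e *: y).
  move=> Ly ey; split.
    apply/mem_psi; rewrite addrAC (le_trans (psi_add _ _))//.
    have := psi_scale y (ltW e_gt0); lra.
  exists (w + e *: y); last by rewrite -wv addrA.
  by move=> u' Lu'; rewrite dotDr dotZr Ly// Lw// mulr0 addr0.
have uL u' : L u' -> dot u' u = 0 by rewrite lineality_span; exact: MW.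
have eu y : psi y <= 1 + psi u + psi (- u) -> e * psi y <= 1 - psi (v j - f).
  by move=> yu; rewrite mulrAC ler_pdivrMr// ler_wpM2l// subr_ge0 ltW.
have P1 : P (v j + e *: u).
  by apply: Pv uL _; apply: eu; have := psi0 (- u); lra.
have P2 : P (v j + e *: - u).
  apply: Pv => [u' Lu'|]; first by rewrite dotNr uL ?oppr0.
  by apply: eu; have := psi0 u; lra.
have cu : dot c (e *: u) = 0.
  have := cd _ P1; have := cd _ P2; rewrite !dotDr !dotZr dotNr cv; lra.
have : (P `&` [set x | dot c x = d]) (v j + e *: u).
  by split=> //=; rewrite dotDr cu addr0.
rewrite vE => /eqP; rewrite -subr_eq0 addrAC subrr add0r scaler_eq0.
by rewrite gt_eqF//= (negbTE u_neq0).
Qed.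

Lemma slice_hull x : P x -> exists lam : 'I_k -> R,
  [/\ forall j, 0 <= lam j, \sum_j lam j = 1 & x = \sum_j lam j *: v j].
Proof.
have [_ _ [A [_ AP PA]]] := mlf_structure.
rewrite {1}PA => -[n [y [w [Ay w0 w1 ->]]]].
have /choice[g gP] : forall i, exists j, v j = y i.
  move=> i; have : range v (y i) by rewrite v_vertices; exact: AP.
  by case=> j _ <-; exists j.
exists (fun j => \sum_(i | g i == j) w i); split.
- by move=> j; rewrite sumr_ge0.
- by rewrite -w1 (partition_big g predT).
- rewrite (partition_big g predT)//=; apply: eq_bigr => j _.
  rewrite scaler_suml; apply: eq_bigr => i /eqP <-.
  by rewrite gP.
Qed.

(** When [psi r > 0], the point [f + r / psi r] of [B] is a convex combination of vertices plus a
    vector of [L]; rescaling by [psi r] gives the weights. *)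
Lemma ray_decomposition r : exists (lam : 'I_k -> R) (m : 'I_h -> R),
  [/\ forall j, 0 <= lam j, \sum_j lam j = psi r &
      r = \sum_j lam j *: (v j - f) + \sum_i m i *: b i].
Proof.
have [r0|r0] := leP (psi r) 0.
  have [m rm] := lineality_coord ((psi_lineality r).2 r0).
  exists (fun=> 0), m; split=> //.
    by rewrite big1//; apply/eqP; rewrite eq_le r0 psi_ge0.
  by rewrite [X in X + _]big1 ?add0r// => i _; rewrite scale0r.
have [BPL _ _] := mlf_structure.
have : B (f + (psi r)^-1 *: r).
  apply/mem_psi; rewrite addrC addKr.
  rewrite (le_trans (psi_scale _ _)) ?invr_ge0 ?(ltW r0)//.
  by rewrite mulVf ?gt_eqF.
rewrite {1}BPL => -[p /slice_hull[lam [lam0 lam1 ->]] [l Ll E]].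
have [m lm] := lineality_coord Ll.
exists (fun j => psi r * lam j), (fun i => psi r * m i); split.
- by move=> j; rewrite mulr_ge0// ltW.
- by rewrite -mulr_sumr lam1 mulr1.
under eq_bigr do rewrite -scalerA scalerBr.
under [X in _ + X]eq_bigr do rewrite -scalerA.
rewrite -!scaler_sumr -lm -scalerDr sumrB -scaler_suml lam1 scale1r.
rewrite addrAC E [f + _]addrC addrK scalerA divff ?scale1r//.
by rewrite gt_eqF.
Qed.

(** A positive multiple of each [b i] is integral, and enough copies of it make the coefficient
    nonnegative. *)
Lemma integral_shift (m : 'I_h -> R) : exists m' : 'I_h -> R,
  (forall i, 0 <= m' i) /\
  lattice (\sum_i m' i *: b i - \sum_i m i *: b i).
Proof.
have [_ _ rat_b] := Lb.
have /choice[d dP] : forall i, exists d : nat, (0 < d)%N /\ lattice (d%:R *: b i).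
  by move=> i; have [d d0 dl] := rational_vector_multiple (rat_b i); exists d.
exists (fun i => m i + (Num.bound `|m i|)%:R * (d i)%:R); split=> [i|].
  have [d0 _] := dP i.
  have h1 := ltW (archi_boundP (normr_ge0 (m i))).
  have h2 : (Num.bound `|m i|)%:R <= (Num.bound `|m i|)%:R * (d i)%:R :> R.
    by rewrite ler_peMr// ler1n.
  have := ler_norm (- m i); rewrite normrN; lra.
rewrite -sumrB; apply: lattice_sum => i _.
rewrite -scalerBl addrC addKr -scalerA; apply: latticeZ; first exact: rpred_nat.
by case: (dP i).
Qed.

Lemma sum_rays (s : 'rV[R]_(k + h)) : \sum_j s 0 j *: rays j =
  \sum_j s 0 (lshift h j) *: (v j - f) + \sum_i s 0 (rshift k i) *: b i.
Proof.
rewrite big_split_ord /Defs.rays /=; congr (_ + _); apply: eq_bigr => i _.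
  by rewrite (unsplitK (inl _)).
by rewrite (unsplitK (inr _)).
Qed.

Lemma dot_split (g s : 'rV[R]_(k + h)) : dot g s =
  \sum_j g 0 (lshift h j) * s 0 (lshift h j) +
  \sum_i g 0 (rshift k i) * s 0 (rshift k i).
Proof. by rewrite /dot big_split_ord. Qed.

Lemma first_onesl j : first_ones R k h 0 (lshift h j) = 1.
Proof. by rewrite row_mxEl mxE. Qed.

Lemma first_onesr i : first_ones R k h 0 (rshift k i) = 0.
Proof. by rewrite row_mxEr mxE. Qed.

Lemma Rf_finite_row (lam : 'I_k -> R) (m : 'I_h -> R) :
  (forall j, 0 <= lam j) -> (forall i, 0 <= m i) ->
  lattice (f + (\sum_j lam j *: (v j - f) + \sum_i m i *: b i)) ->
  Rf_finite f rays (row_mx (\row_j lam j) (\row_i m i)).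
Proof.
move=> lam0 m0 l; split=> [j|].
  by rewrite -(splitK j); case: (fintype.split j) => i /=;
    rewrite ?row_mxEl ?row_mxEr mxE.
rewrite sum_rays; under eq_bigr do rewrite row_mxEl mxE.
by under [X in _ + (_ + X)]eq_bigr do rewrite row_mxEr mxE.
Qed.

Lemma first_ones_valid :
  valid_inequality (convex_hull (Rf_finite f rays)) (first_ones R k h).
Proof.
apply/valid_convex_hull => s [s0]; rewrite sum_rays => sl.
have := psi_lattice sl; rewrite addrC addKr => /le_trans; apply.
rewrite (le_trans (psi_add _ _))// dot_split lerD//.
  rewrite (le_trans (psi_sum _ _))// ler_sum// => j _.
  by rewrite psi_vertex first_onesl.
rewrite [leRHS]big1 => [|i _]; last by rewrite first_onesr mul0r.
exact/psi_lineality/lineality_sum.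
Qed.

(* A valid inequality with nonpositive coefficients on the basis of L may be
   evaluated at arbitrary multipliers on that basis, since these can be made
   nonnegative by adding integral vectors. *)
Lemma valid_free_lineality (g : 'rV[R]_(k + h)) :
  valid_inequality (Rf_finite f rays) g ->
  (forall i, g 0 (rshift k i) <= 0) ->
  forall (lam : 'I_k -> R) (m : 'I_h -> R), (forall j, 0 <= lam j) ->
    lattice (f + (\sum_j lam j *: (v j - f) + \sum_i m i *: b i)) ->
    1 <= \sum_j g 0 (lshift h j) * lam j.
Proof.
move=> vg g0 lam m lam0 l; have [m' [m'0 m'l]] := integral_shift m.
have s_in : Rf_finite f rays (row_mx (\row_j lam j) (\row_i m' i)).
  apply: Rf_finite_row => //; move: (latticeD l m'l).
  by rewrite -!addrA [X in _ + (_ + X)]addrC subrK.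
apply: le_trans (vg _ s_in) _; rewrite dot_split -[leRHS]addr0 lerD//.
  by rewrite ler_sum// => j _; rewrite row_mxEl mxE.
by rewrite sumr_le0// => i _; rewrite row_mxEr mxE mulr_le0_ge0.
Qed.

(** Adding integral multiples of [b i] keeps a solution feasible, so a negative coefficient would
    make the left side arbitrarily small. The initial solution decomposes [- f], thus reaching 0 up
    to a lattice shift. *)
Lemma valid_basis_coef_ge0 (g : 'rV[R]_(k + h)) i :
  valid_inequality (Rf_finite f rays) g -> 0 <= g 0 (rshift k i).
Proof.
move=> vg.
have [lam [m [lam0 _ fE]]] := ray_decomposition (- f).
have [m' [m'0 m'l]] := integral_shift m.
have [_ _ /(_ i)/rational_vector_multiple[d d0 dl]] := Lb.
pose m'' (n : nat) i' := m' i' + (n * d * (i' == i))%:R.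
have m''E n : \sum_i' m'' n i' *: b i' =
    \sum_i' m' i' *: b i' + n%:R *: (d%:R *: b i).
  under eq_bigr do rewrite scalerDl.
  rewrite big_split /= [X in _ + X](bigD1 i)//= [X in _ + (_ + X)]big1.
    by rewrite addr0 eqxx muln1 scalerA natrM.
  by move=> i' /negbTE ->; rewrite muln0 scale0r.
have s_in n : Rf_finite f rays (row_mx (\row_j lam j) (\row_i m'' n i)).
  apply: Rf_finite_row => // [i'|]; first by rewrite addr_ge0.
  have -> : f + (\sum_j lam j *: (v j - f) + \sum_i0 m'' n i0 *: b i0) =
     (\sum_i m' i *: b i - \sum_i m i *: b i) + n%:R *: (d%:R *: b i).
    rewrite m''E -[X in X + _ = _]opprK [X in - X + _ = _]fE.
    by apply/rowP => i'; rewrite !mxE; ring.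
  by apply: latticeD => //; apply: latticeZ => //; exact: rpred_nat.
rewrite leNgt; apply/negP => gi.
pose A := dot g (row_mx (\row_j lam j) (\row_i m' i)).
have : forall n : nat, 1 <= A + n%:R * (d%:R * g 0 (rshift k i)).
  move=> n; have := vg _ (s_in n).
  suff -> : dot g (row_mx (\row_j lam j) (\row_i m'' n i)) =
    A + n%:R * (d%:R * g 0 (rshift k i)) by [].
  have -> : row_mx (\row_j lam j) (\row_i m'' n i) =
      row_mx (\row_j lam j) (\row_i m' i) + (n * d)%:R *: delta_mx 0 (rshift k i).
    apply/rowP => j; rewrite -(splitK j); case: (fintype.split j) => i' /=.
      by rewrite !mxE !(unsplitK (inl _)) !mxE /= eq_lrshift mulr0 addr0.
    rewrite !mxE !(unsplitK (inr _)) !mxE /= eq_rshift /m''.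
    by rewrite natrM.
  by rewrite dotDr dotZr [dot g (delta_mx _ _)]dotC dot_delta natrM mulrA.
set e := d%:R * _ => hA.
have e0 : e < 0 by rewrite pmulr_rlt0// ltr0n.
have := hA (Num.bound (`|A| / - e)).
have A0 : 0 <= `|A| / - e by rewrite divr_ge0// oppr_ge0 ltW.
have := archi_boundP A0; rewrite ltr_pdivrMr ?oppr_gt0// => h1.
have := ler_norm A; lra.
Qed.

Lemma extreme_finite_of_infinite : extreme_infinite f psi ->
  extreme_inequality (convex_hull (Rf_finite f rays)) (first_ones R k h).
Proof.
move=> [_ not_split]; split; first exact: first_ones_valid.
move=> [al [be [albe avg /valid_convex_hull val /valid_convex_hull vbe]]].
apply: not_split.
(* Both coefficients are nonnegative and their mean is at most 0. *)
have albe0 i : al 0 (rshift k i) = 0 /\ be 0 (rshift k i) = 0.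
  have := valid_basis_coef_ge0 i val; have := valid_basis_coef_ge0 i vbe.
  have := avg (rshift k i); rewrite first_onesr; split; lra.
(* At [v j - f] the decomposition is forced to be the trivial one, so that the extensions [F al] and
   [F be] take the original coefficients there and remain distinct. *)
have /choice[D DP] : forall r, exists p : ('I_k -> R) * ('I_h -> R),
    [/\ forall j, 0 <= p.1 j, \sum_j p.1 j = psi r,
        r = \sum_j p.1 j *: (v j - f) + \sum_i p.2 i *: b i &
        forall j, r = v j - f -> forall i, p.1 i = (i == j)%:R].
  move=> r; have [[j rj]|rv] := pselect (exists j, r = v j - f).
    exists (fun i => (i == j)%:R, fun=> 0); split=> //=.
    - by rewrite (bigD1 j)//= eqxx big1 ?addr0 ?rj ?psi_vertex// => i /negbTE ->.
    - rewrite [X in _ + X]big1 ?addr0 => [|i _]; last by rewrite scale0r.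
      rewrite (bigD1 j)//= eqxx scale1r big1 ?addr0// => i /negbTE ->.
      by rewrite scale0r.
    - move=> j'; rewrite rj => /(congr1 (+%R^~ f)); rewrite !subrK.
      by move=> /v_inj <-.
  have [lam [m [lam0 lam1 rE]]] := ray_decomposition r.
  by exists (lam, m); split=> // j rj; case: rv; exists j.
pose F (g : 'rV[R]_(k + h)) r := \sum_j g 0 (lshift h j) * (D r).1 j.
have validF g : valid_inequality (Rf_finite f rays) g ->
    (forall i, g 0 (rshift k i) <= 0) -> valid_infinite f (F g).
  move=> vg g0; apply: family_valid_infinite => n r w w0 l.
  pose lam j := \sum_i w i * (D (r i)).1 j.
  pose m i' := \sum_i w i * (D (r i)).2 i'.
  have -> : \sum_i F g (r i) * w i = \sum_j g 0 (lshift h j) * lam j.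
    under eq_bigr do rewrite mulr_suml.
    rewrite exchange_big; apply: eq_bigr => j _; rewrite mulr_sumr.
    by apply: eq_bigr => i _; rewrite -mulrA [_ * w i]mulrC.
  apply: (valid_free_lineality vg g0 (m := m)) => [j|].
    by rewrite sumr_ge0// => i _; rewrite mulr_ge0//; case: (DP (r i)).
  suff <- : \sum_i w i *: r i =
    \sum_j lam j *: (v j - f) + \sum_i m i *: b i by [].
  under [in RHS]eq_bigr do rewrite scaler_suml.
  under [X in _ = _ + X]eq_bigr do rewrite scaler_suml.
  rewrite exchange_big [X in _ = _ + X]exchange_big -big_split /=.
  apply: eq_bigr => i _; have [_ _ rE _] := DP (r i).
  by rewrite [in LHS]rE scalerDr !scaler_sumr; congr (_ + _); apply: eq_bigr => j _;
    rewrite scalerA.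
exists (F al), (F be); split.
- move=> FE; apply: albe; apply/rowP => j.
  rewrite -(splitK j); case: (fintype.split j) => i /=; last first.
    by have [-> ->] := albe0 i.
  have Fv g : F g (v i - f) = g 0 (lshift h i).
    have [_ _ _ /(_ i erefl) De] := DP (v i - f).
    rewrite /F (bigD1 i)//= De eqxx mulr1 big1 ?addr0// => i' /negbTE i'i.
    by rewrite De i'i mulr0.
  by rewrite -!Fv FE.
- move=> r; have [D0 <- _ _] := DP r.
  rewrite ler_pdivrMr// mulr_suml /F -big_split /= ler_sum// => j _.
  rewrite -mulrDl mulrC ler_wpM2l//.
  by have := avg (lshift h j); rewrite first_onesl; lra.
- by apply: validF => // i; have [-> _] := albe0 i.
- by apply: validF => // i; have [_ ->] := albe0 i.
Qed.

(** By [psi_minimal] it suffices to combine [r0] with an arbitrary [x]. Decomposing [x] along the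
    rays costs at most [psi x] under [phi], up to a lattice shift. *)
Lemma valid_ge_psi (phi : 'rV[R]_q -> R) : valid_infinite f phi ->
  (forall j, phi (rays j) <= first_ones R k h 0 j) ->
  forall r, psi r <= phi r.
Proof.
move=> vphi phi1 r0; apply: psi_minimal => s x s0 sl.
have [lam [m [lam0 lam1 xE]]] := ray_decomposition x.
have [m' [m'0 m'l]] := integral_shift m.
pose w := row_mx (\row_j lam j) (\row_i m' i) : 'rV[R]_(k + h).
have w_ge0 j : 0 <= w 0 j.
  by rewrite -(splitK j); case: (fintype.split j) => i /=;
    rewrite ?row_mxEl ?row_mxEr mxE.
have wE : \sum_j w 0 j *: rays j =
    \sum_j lam j *: (v j - f) + \sum_i m' i *: b i.
  rewrite sum_rays; under eq_bigr do rewrite row_mxEl mxE.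
  by under [X in _ + X]eq_bigr do rewrite row_mxEr mxE.
(* A family is used since [r0] may itself be one of the rays. *)
have := @valid_infinite_family _ _ _ _ vphi ('I_1 + 'I_(k + h))%type
  (fun o => if o is inr j then rays j else r0)
  (fun o => if o is inr j then w 0 j else s).
rewrite !big_sumType /= !big_ord1 wE.
have w_ge0' : forall o : ('I_1 + 'I_(k + h))%type,
    0 <= (if o is inr j then w 0 j else s).
  by case.
move=> /(_ w_ge0'); have -> : f + (s *: r0 +
    (\sum_j lam j *: (v j - f) + \sum_i m' i *: b i)) =
    (f + s *: r0 + x) + (\sum_i m' i *: b i - \sum_i m i *: b i).
  by rewrite xE; apply/rowP => i; rewrite !mxE; ring.
move=> /(_ (latticeD sl m'l)) /le_trans; apply; rewrite lerD2l -lam1.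
apply: (@le_trans _ _ (dot (first_ones R k h) w)).
  by apply: ler_sum => j _; rewrite ler_wpM2r.
rewrite dot_split [X in _ + X]big1 ?addr0 => [|i _].
  by apply: ler_sum => j _; rewrite first_onesl mul1r row_mxEl mxE.
by rewrite first_onesr mul0r.
Qed.

Lemma extreme_infinite_of_finite :
  extreme_inequality (convex_hull (Rf_finite f rays)) (first_ones R k h) ->
  extreme_infinite f psi.
Proof.
move=> [_ not_split]; split; first exact: psi_valid.
move=> [psi1 [psi2 [psi12 avg v1 v2]]].
pose al phi : 'rV[R]_(k + h) := \row_j phi (rays j).
have psi_rays j : psi (rays j) <= first_ones R k h 0 j.
  rewrite -(splitK j); case: (fintype.split j) => i /=; rewrite /Defs.rays.
    by rewrite (unsplitK (inl _)) psi_vertex first_onesl.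
  rewrite (unsplitK (inr _)) first_onesr.
  exact/psi_lineality/basis_lineality.
have avg' j : (psi1 (rays j) + psi2 (rays j)) / 2 <= first_ones R k h 0 j.
  exact: le_trans (avg _) (psi_rays j).
have val phi : valid_infinite f phi ->
    valid_inequality (convex_hull (Rf_finite f rays)) (al phi).
  move=> vphi; apply/valid_convex_hull => s [s0 sl].
  rewrite (le_trans (valid_infinite_family vphi s0 sl))// /dot.
  by rewrite ler_sum// => j _; rewrite mxE.
have [E|neq] := pselect (al psi1 = al psi2); last first.
  apply: not_split; exists (al psi1), (al psi2); split; try exact: val.
    exact: neq.
  by move=> j; rewrite [al psi1 _ _]mxE [al psi2 _ _]mxE.
have Ej j : psi1 (rays j) = psi2 (rays j).
  by move/rowP: E => /(_ j); rewrite !mxE.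
(* On the rays the common value is at most that of [first_ones], so [psi1] and [psi2] are both at
   least [psi]; the bound on their mean then forces equality. *)
apply: psi12; apply/funext => r.
have p1 : psi r <= psi1 r.
  by apply: valid_ge_psi => // j; have := avg' j; rewrite -Ej; lra.
have p2 : psi r <= psi2 r.
  by apply: valid_ge_psi => // j; have := avg' j; rewrite Ej; lra.
have := avg r; lra.
Qed.

End Gauge.

End MaximalLatticeFree.

Theorem theorem5 (R : realType) (q : nat) (f : 'rV[R]_q) (B : set 'rV[R]_q)
    (hB : maximal_lattice_free_convex B) (hf : B° f) :
  let L := lineality_space B in
  let P := B `&` [set f + y | y in orthogonal_complement L] in
  [/\ B = [set p + l | p in P & l in L],
      rational_space L,
      polytope P &
      forall (k h : nat) (v : 'I_k -> 'rV[R]_q) (b : 'I_h -> 'rV[R]_q),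
        injective v -> range v = vertices P -> rational_basis L b ->
      forall (t : nat) (a : 'I_t.+1 -> 'rV[R]_q),
        irredundant_description f B a ->
        (extreme_infinite f (psi_of a) <->
         extreme_inequality (convex_hull (Rf_finite f (rays f v b)))
                            (first_ones R k h))].
Proof.
move=> L P; have [BPL ratL [A [finA _ PA]]] := mlf_structure hB hf.
split=> //; first by exists A.
move=> k h v b v_inj vP Lb t a [Ba _]; split.
  exact: (extreme_finite_of_infinite hB hf Ba v_inj vP Lb).
exact: (extreme_infinite_of_finite hB hf Ba vP Lb).
Qed.
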